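(* Let $\bar{\mathbf U}_{i-1}^n,\bar{\mathbf U}_i^n,\bar{\mathbf U}_{i+1}^n\in G$ with $\bar{\mathbf U}_i^n\ne\bar{\mathbf U}_{i\pm1}^n$, let $\Phi_{i-1,i}$ and $\Phi_{i,i+1}$ be generalized paths connecting $\bar{\mathbf U}_{i-1}^n$ to $\bar{\mathbf U}_i^n$ and $\bar{\mathbf U}_i^n$ to $\bar{\mathbf U}_{i+1}^n$, respectively, and let $\bar{\mathbf U}_i^{n+1}\in G$ be given by $$\bar{\mathbf U}_i^{n+1}=\bar{\mathbf U}_i^n-\lambda\big(\hat{\mathbf F}(\bar{\mathbf U}_i^n,\bar{\mathbf U}_{i+1}^n)-\hat{\mathbf F}(\bar{\mathbf U}_{i-1}^n,\bar{\mathbf U}_i^n)\big)-\lambda\big(\mathcal A^-_{i,i+1}+\mathcal A^+_{i-1,i}\big).$$ Put $\mathbf d^\pm=\bar{\mathbf U}_{i\pm1}^n-\bar{\mathbf U}_i^n$, $\mathbf U_\xi^\pm=\bar{\mathbf U}_i^n+\xi\mathbf d^\pm$, and $$\Delta\mathcal A^+=\int_0^1\Big(\mathcal U'(\mathbf U_\xi^+)\mathbf S(\mathbf U_\xi^+)B_x'\mathbf d^+-\mathcal U'(\bar{\mathbf U}_i^n)\mathbf S(\Phi_{i,i+1}(\xi))B_x'\Phi_{i,i+1}'(\xi)\Big)\mathrm d\xi,$$ $$\Delta\mathcal A^-=\int_0^1\Big(\mathcal U'(\mathbf U_\xi^-)\mathbf S(\mathbf U_\xi^-)B_x'\mathbf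 d^-+\mathcal U'(\bar{\mathbf U}_i^n)\mathbf S(\Phi_{i-1,i}(\xi))B_x'\Phi_{i-1,i}'(\xi)\Big)\mathrm d\xi.$$ Suppose the wave speeds satisfy $$\mathcal S_R(\bar{\mathbf U}_i^n,\bar{\mathbf U}_{i+1}^n)\ge\frac{\int_0^1\int_0^\xi(\mathbf d^+)^T\mathcal U''(\mathbf U_\zeta^+)\mathbf F'(\mathbf U_\xi^+)\mathbf d^+\,\mathrm d\zeta\,\mathrm d\xi+\Delta\mathcal A^+}{\int_0^1\int_0^\xi(\mathbf d^+)^T\mathcal U''(\mathbf U_\zeta^+)\mathbf d^+\,\mathrm d\zeta\,\mathrm d\xi},$$ $$\mathcal S_L(\bar{\mathbf U}_{i-1}^n,\bar{\mathbf U}_i^n)\le\frac{\int_0^1\int_0^\xi(\mathbf d^-)^T\mathcal U''(\mathbf U_\zeta^-)\mathbf F'(\mathbf U_\xi^-)\mathbf d^-\,\mathrm d\zeta\,\mathrm d\xi+\Delta\mathcal A^-}{\int_0^1\int_0^\xi(\mathbf d^-)^T\mathcal U''(\mathbf U_\zeta^-)\mathbf d^-\,\mathrm d\zeta\,\mathrm d\xi}.$$ Define $$T_1=\hat{\mathcal F}(\bar{\mathbf U}_i^n,\bar{\mathbf U}_{i+1}^n)-\hat{\mathcal F}(\bar{\mathbf U}_i^n,\bar{\mathbf U}_i^n)-\mathcal U'(\bar{\mathbf U}_i^n)\big(\hat{\mathbf F}(\bar{\mathbf U}_i^n,\bar{\mathbf U}_{i+1}^n)-\hat{\mathbf F}(\bar{\mathbf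 U}_i^n,\bar{\mathbf U}_i^n)+\mathcal A^-_{i,i+1}\big),$$ $$T_2=\hat{\mathcal F}(\bar{\mathbf U}_{i-1}^n,\bar{\mathbf U}_i^n)-\hat{\mathcal F}(\bar{\mathbf U}_i^n,\bar{\mathbf U}_i^n)-\mathcal U'(\bar{\mathbf U}_i^n)\big(\hat{\mathbf F}(\bar{\mathbf U}_{i-1}^n,\bar{\mathbf U}_i^n)-\hat{\mathbf F}(\bar{\mathbf U}_i^n,\bar{\mathbf U}_i^n)-\mathcal A^+_{i-1,i}\big),$$ $$T_3=\hat{\mathbf F}(\bar{\mathbf U}_i^n,\bar{\mathbf U}_{i+1}^n)-\hat{\mathbf F}(\bar{\mathbf U}_{i-1}^n,\bar{\mathbf U}_i^n)+\mathcal A^-_{i,i+1}+\mathcal A^+_{i-1,i}.$$ Let $L(\mathbf a,\mathbf b)=\{s\mathbf a+(1-s)\mathbf b:s\in[0,1]\}$. Then, under the CFL condition $$0\le\lambda\le\frac{2(T_2-T_1)}{\|T_3\|^2}\Big(\max_{\boldsymbol\eta\in L(\bar{\mathbf U}_i^n,\bar{\mathbf U}_i^{n+1})}\sigma_{\max}(\mathcal U''(\boldsymbol\eta))\Big)^{-1}$$ (where the upper bound is understood to be vacuous if $T_3=0$), the scheme is entropy stable in the sense that $$\mathcal U(\bar{\mathbf U}_i^{n+1})\le\mathcal U(\bar{\mathbf U}_i^n)-\lambda\big(\hat{\mathcal F}(\bar{\mathbf U}_i^n,\bar{\mathbf U}_{i+1}^n)-\hat{\mathcal F}(\bar{\mathbf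 U}_{i-1}^n,\bar{\mathbf U}_i^n)\big).$$
   Context: **MHD system (flow varying in $x$ only).** The state is $\mathbf U=(\rho,\rho\mathbf u,\mathcal E,\mathbf B)\in\mathbb R^p$ with $\mathbf u,\mathbf B\in\mathbb R^m$ ($m\in\{1,2,3\}$, $p=2m+2$); $u_x,B_x$ are the first components of $\mathbf u,\mathbf B$. With $\gamma=5/3$, the pressure $P$ is defined by $\mathcal E=\frac{P}{\gamma-1}+\frac12\rho\|\mathbf u\|^2+\frac12\|\mathbf B\|^2$, and $P^\star=P+\frac12\|\mathbf B\|^2$. The admissible set is $G=\{\mathbf U:\rho>0,\ P>0\}$ (a convex set); all states and paths take values in $G$. The $x$-flux is $\mathbf F(\mathbf U)=(\rho u_x,\ \rho u_x\mathbf u+P^\star\mathbf e_1-B_x\mathbf B,\ u_x(\mathcal E+P^\star)-B_x(\mathbf u\cdot\mathbf B),\ u_x\mathbf B-B_x\mathbf u)$. Entropy and entropy flux: $\mathcal U=-\frac{\rho s}{\gamma-1}$, $\mathcal F=-\frac{\rho s u_x}{\gamma-1}$, $s=\ln(P\rho^{-\gamma})$; $\mathcal U$ is strictly convex on $G$ with positive definite Hessian $\mathcal U''$. $\mathcal U'$ is the gradient as a row vector, and $\mathbf V=\mathcal U'(\mathbf U)^T$. With $\beta=\rho/(2P)$ and $\phi(\mathbf V)=2\beta(\mathbf u\cdot\mathbf B)$, set $\mathbf S(\mathbf U)=\phi'(\mathbf V)^T=(0,\mathbf B,\mathbf u\cdot\mathbf B,\mathbf u)^T$. $B_x'=\partial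 B_x/\partial\mathbf U$ is the constant row vector with entry $1$ in the $B_x$ position and $0$ elsewhere. One has $\mathcal F'=\mathcal U'\mathbf F'+\phi(\mathbf V)B_x'$ and $\mathcal U'(\mathbf U)\mathbf S(\mathbf U)=\phi(\mathbf V)$. The system being discretized is $\partial_t\mathbf U+\partial_x\mathbf F(\mathbf U)=-\mathbf S(\mathbf U)\partial_xB_x$. **Scheme.** $\lambda=\Delta t/h$ is the ratio of time step to mesh size. A generalized path connecting $\mathbf a$ to $\mathbf b$ is a Lipschitz function $\Phi:[0,1]\to G$ with $\Phi(0)=\mathbf a$, $\Phi(1)=\mathbf b$. To each pair of neighbouring states $(\mathbf U^-,\mathbf U^+)$ are assigned real wave speeds $\mathcal S_R=\mathcal S_R(\mathbf U^-,\mathbf U^+)\ge0$, $\mathcal S_L=\mathcal S_L(\mathbf U^-,\mathbf U^+)\le0$ with $\mathcal S_R>\mathcal S_L$. The HLL flux and HLL numerical entropy flux are $$\hat{\mathbf F}(\mathbf U^-,\mathbf U^+)=\frac{\mathcal S_R\mathbf F(\mathbf U^-)-\mathcal S_L\mathbf F(\mathbf U^+)+\mathcal S_R\mathcal S_L(\mathbf U^+-\mathbf U^-)}{\mathcal S_R-\mathcal S_L},$$ $$\hat{\mathcal F}(\mathbf U^-,\mathbf U^+)=\frac{\mathcal S_R\mathcal F(\mathbf U^-)-\mathcal S_L\mathcal F(\mathbf U^+)+\mathcal S_R\mathcal S_L(\mathcal U(\mathbf U^+)-\mathcal U(\mathbf U^-))}{\mathcal S_R-\mathcal S_L},$$ so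 $\hat{\mathbf F}(\mathbf U,\mathbf U)=\mathbf F(\mathbf U)$ and $\hat{\mathcal F}(\mathbf U,\mathbf U)=\mathcal F(\mathbf U)$. With $\mathcal R^+=\frac{\mathcal S_R}{\mathcal S_R-\mathcal S_L}$, $\mathcal R^-=\frac{-\mathcal S_L}{\mathcal S_R-\mathcal S_L}$ evaluated with the wave speeds of the pair $(\bar{\mathbf U}_j^n,\bar{\mathbf U}_{j+1}^n)$, $$\mathcal A^\pm_{j,j+1}=\mathcal R^\pm_{j,j+1}\int_0^1\mathbf S(\Phi_{j,j+1}(\xi))B_x'\Phi_{j,j+1}'(\xi)\,\mathrm d\xi .$$ $\sigma_{\max}$ denotes the largest eigenvalue and $\|\cdot\|$ the Euclidean norm. *)

(* Defs.v *)
From HB Require Import structures.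
From mathcomp Require Import all_boot all_order all_algebra.
From mathcomp Require Import all_classical all_reals all_analysis.

Set Implicit Arguments.
Unset Strict Implicit.
Unset Printing Implicit Defensive.

Import Order.TTheory GRing.Theory Num.Theory.
Import numFieldNormedType.Exports.

Local Open Scope classical_set_scope.
Local Open Scope ring_scope.

Section Calculus.
Context {R : realType}.

Definition dotv (k : nat) (x y : 'cV[R]_k) : R := (x^T *m y) 0 0.

(* Euclidean norm; the library norm `|x| on matrices is the max norm. *)
Definition norm2 (k : nat) (x : 'cV[R]_k) : R := Num.sqrt (dotv x x).

Definition grad (k : nat) (f : 'cV[R]_k -> R) (x : 'cV[R]_k) : 'rV[R]_k :=
  \row_j 'D_(delta_mx j 0) f x.

Definition jac (k l : nat) (f : 'cV[R]_k -> 'cV[R]_l) (x : 'cV[R]_k) :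
    'M[R]_(l, k) :=
  \matrix_(i, j) 'D_(delta_mx j 0) (fun y => f y i 0) x.

Definition hess (k : nat) (f : 'cV[R]_k -> R) : 'cV[R]_k -> 'M[R]_k :=
  jac (fun y => (grad f y)^T).

(* Only used for symmetric matrices (Hessians), whose set of real eigenvalues
   is finite and nonempty, so that the supremum is a maximum. *)
Definition sigma_max (k : nat) (A : 'M[R]_k) : R :=
  sup [set a : R | eigenvalue A a].

Definition segm (k : nat) (a b : 'cV[R]_k) : set 'cV[R]_k :=
  [set s *: a + (1 - s) *: b | s in `[0%R, 1%R]].

(* Lebesgue integrals over an interval, of real-valued functions ... *)
Definition Lint (a b : R) (f : R -> R) : R :=
  \int[@lebesgue_measure R]_(t in `[a, b]) f t.

(* ... and, componentwise, of vector-valued ones. *)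
Definition Vint (k : nat) (a b : R) (f : R -> 'cV[R]_k) : 'cV[R]_k :=
  \col_i Lint a b (fun t => f t i 0).

End Calculus.

(* The vectors u and B have n.+1 components, so that they have a first one; a
   state is the column (rho, rho u, E, B) of length 2 * n.+1 + 2. *)
Notation mhd_dim n := (1 + (n.+1 + (1 + n.+1)))%N.
Notation state R n := 'cV[R]_(mhd_dim n).

Section MHD.
Context {R : realType} {n : nat}.
Implicit Types U a b d : state R n.

Definition gam : R := 5%:R / 3%:R.

Definition rho U : R := usubmx U 0 0.
Definition mom U : 'cV[R]_n.+1 := usubmx (dsubmx U).
Definition energy U : R := usubmx (dsubmx (dsubmx U)) 0 0.
Definition mag U : 'cV[R]_n.+1 := dsubmx (dsubmx (dsubmx U)).

Definition vel U : 'cV[R]_n.+1 := (rho U)^-1 *: mom U.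
Definition ux U : R := vel U 0 0.
Definition Bx U : R := mag U 0 0.

Definition pressure U : R :=
  (gam - 1) * (energy U - 2^-1 * rho U * norm2 (vel U) ^+ 2
               - 2^-1 * norm2 (mag U) ^+ 2).

Definition pstar U : R := pressure U + 2^-1 * norm2 (mag U) ^+ 2.

Definition G : set (state R n) := [set U | 0 < rho U /\ 0 < pressure U].

Definition flux U : state R n :=
  col_mx (rho U * ux U)%:M
 (col_mx ((rho U * ux U) *: vel U + pstar U *: delta_mx 0 0 - Bx U *: mag U)
 (col_mx (ux U * (energy U + pstar U) - Bx U * dotv (vel U) (mag U))%:M
         (ux U *: mag U - Bx U *: vel U))).

Definition spec_entropy U : R := ln (pressure U * rho U `^ (- gam)).

Definition entropy U : R := - (rho U * spec_entropy U) / (gam - 1).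

Definition entropy_flux U : R :=
  - (rho U * spec_entropy U * ux U) / (gam - 1).

Definition source U : state R n :=
  col_mx 0 (col_mx (mag U) (col_mx (dotv (vel U) (mag U))%:M (vel U))).

(* The constant derivative B_x' of B_x with respect to the state. *)
Definition dBx : 'rV[R]_(mhd_dim n) :=
  row_mx 0 (row_mx 0 (row_mx 0 (delta_mx 0 0))).

(* Only the values of Phi on [0, 1] matter below: its two-sided derivative
   at 0 and 1 may see other values, but only enters integrals. The max norm
   underlying lipschitz is equivalent to the Euclidean one. *)
Definition gen_path (Phi : R -> state R n) a b : Prop :=
  [/\ Phi 0 = a, Phi 1 = b,
      (forall xi : R, xi \in `[0, 1] -> G (Phi xi)) &
      exists k : R, k.-lipschitz_`[0, 1] Phi].

Section Scheme.
Variables SR SL : state R n -> state R n -> R.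

Definition wave_speeds : Prop :=
  forall a b, G a -> G b -> [/\ 0 <= SR a b, SL a b <= 0 & SL a b < SR a b].

Definition hll_flux a b : state R n :=
  (SR a b - SL a b)^-1 *:
    (SR a b *: flux a - SL a b *: flux b + (SR a b * SL a b) *: (b - a)).

Definition hll_entropy_flux a b : R :=
  (SR a b * entropy_flux a - SL a b * entropy_flux b
   + SR a b * SL a b * (entropy b - entropy a)) / (SR a b - SL a b).

Definition Rplus a b : R := SR a b / (SR a b - SL a b).
Definition Rminus a b : R := - SL a b / (SR a b - SL a b).

Definition path_int (Phi : R -> state R n) : state R n :=
  Vint 0 1 (fun xi => source (Phi xi) *m (dBx *m derive1 Phi xi)).

Definition Aplus a b (Phi : R -> state R n) : state R n :=
  Rplus a b *: path_int Phi.
Definition Aminus a b (Phi : R -> state R n) : state R n :=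
  Rminus a b *: path_int Phi.

(* In the three definitions below, Um, U and Up are the states of the cells
   i - 1, i and i + 1, and Phim and Phip the paths from Um to U and from U
   to Up. *)
Definition T1 U Up (Phip : R -> state R n) : R :=
  hll_entropy_flux U Up - hll_entropy_flux U U
  - (grad entropy U *m
      (hll_flux U Up - hll_flux U U + Aminus U Up Phip)) 0 0.

Definition T2 Um U (Phim : R -> state R n) : R :=
  hll_entropy_flux Um U - hll_entropy_flux U U
  - (grad entropy U *m
      (hll_flux Um U - hll_flux U U - Aplus Um U Phim)) 0 0.

Definition T3 Um U Up (Phim Phip : R -> state R n) : state R n :=
  hll_flux U Up - hll_flux Um U + Aminus U Up Phip + Aplus Um U Phim.

End Scheme.

Definition deltaA_plus U d (Phi : R -> state R n) : R :=
  Lint 0 1 (fun xi =>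
    (grad entropy (U + xi *: d) *m source (U + xi *: d) *m dBx *m d) 0 0
    - (grad entropy U *m source (Phi xi) *m dBx *m derive1 Phi xi) 0 0).

Definition deltaA_minus U d (Phi : R -> state R n) : R :=
  Lint 0 1 (fun xi =>
    (grad entropy (U + xi *: d) *m source (U + xi *: d) *m dBx *m d) 0 0
    + (grad entropy U *m source (Phi xi) *m dBx *m derive1 Phi xi) 0 0).

Definition flux_form U d : R :=
  Lint 0 1 (fun xi => Lint 0 xi (fun zeta =>
    (d^T *m hess entropy (U + zeta *: d) *m jac flux (U + xi *: d) *m d) 0 0)).

Definition entropy_form U d : R :=
  Lint 0 1 (fun xi => Lint 0 xi (fun zeta =>
    (d^T *m hess entropy (U + zeta *: d) *m d) 0 0)).

End MHD.

(* Main.v *)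
Require Import Defs.
From mathcomp Require Import all_boot all_order all_algebra.
From mathcomp Require Import all_classical all_reals all_analysis.
From mathcomp Require Import measurable_realfun ring lra.

Set Implicit Arguments.
Unset Strict Implicit.
Unset Printing Implicit Defensive.

Import Order.TTheory GRing.Theory Num.Theory.
Import numFieldNormedType.Exports.

Local Open Scope classical_set_scope.
Local Open Scope ring_scope.

(** Along the segment from U to U + d the entropy and its flux q are smooth
functions of one variable. Integrating q' = U' F' + phi B_x' along it shows
that the HLL residuals T1 and T2 are R^- and R^+ times the defects in the wave
speed conditions, so that T1 <= 0 <= T2. Moreover T1 - T2 is the entropy flux
difference minus U' T3, and a second order Taylor expansion of the entropy
between U and U - lambda T3, with the Hessian bounded by its largest
eigenvalue, turns the CFL condition into the entropy inequality. Splitting the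
integrals that define the path terms requires the derivative of a Lipschitz
path to be measurable, although it need not exist everywhere. *)

Section PathDerivative.
Context {R : realType} {k : nat}.
Implicit Types (F : R -> 'cV[R]_k) (x h : R).

Lemma entry_le_norm m n (M : 'M[R]_(m, n)) i j : `|M i j| <= `|M|.
Proof.
rewrite [leRHS]mx_normrE.
exact: (le_bigmax _ (fun ij : 'I_m * 'I_n => `|M ij.1 ij.2|) (i, j)).
Qed.

Definition diff_quot F h x : 'cV[R]_k := h^-1 *: (F (h + x) - F x).

(* By completeness, differentiability at x is a Cauchy condition on difference
   quotients, hence a countable combination of closed conditions on x. *)
Definition quot_cauchy F (e d : R) : set R :=
  [set x | forall a b : R, 0 < `|a| < d -> 0 < `|b| < d ->
     `|diff_quot F a x - diff_quot F b x| <= e].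

Lemma derivable1E F x :
  derivable F x 1 <-> cvg (diff_quot F h x @[h --> 0^']).
Proof.
rewrite /derivable.
suff -> : (fun h : R => h^-1 *: ((F \o shift x) (h *: 1) - F x)) =
          diff_quot F ^~ x by [].
by apply/funext => h; rewrite /diff_quot /= /GRing.scale /= mulr1.
Qed.

Lemma derivable_quot_cauchyP F x : derivable F x 1 <->
  (\bigcap_k \bigcup_m quot_cauchy F (k.+1%:R^-1) (m.+1%:R^-1)) x.
Proof.
rewrite derivable1E; split.
- move=> /cvg_ex[l Fl] i _.
  have e0 : 0 < (i.+1%:R^-1 / 2 : R) by rewrite divr_gt0 ?invr_gt0.
  have /cvgrPdist_le/(_ _ e0)/nbhs_ballP[d /= d0 Hd] :
    diff_quot F h x @[h --> 0^'] --> (l : 'cV[R]_k) by [].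
  have [m md] := ltr_add_invr d0.
  rewrite add0r in md.
  exists m => //= a b /andP[a0 am] /andP[b0 bm].
  have H h : 0 < `|h| -> `|h| < m.+1%:R^-1 -> `|l - diff_quot F h x| <= i.+1%:R^-1 / 2.
    move=> h0 hm; apply: Hd.
      by rewrite /ball /= sub0r normrN (lt_trans hm).
    by rewrite -normr_gt0.
  have -> : diff_quot F a x - diff_quot F b x =
      (l - diff_quot F b x) - (l - diff_quot F a x).
    by rewrite [RHS]addrC opprB addrA subrK.
  rewrite (splitr (i.+1%:R^-1)) (le_trans (ler_normB _ _))// lerD// H//.
- move=> H; apply/cauchy_cvgP/cauchy_exP => e e0.
  have [i ie] := ltr_add_invr e0.
  rewrite add0r in ie.
  have [m _ /= Hm] := H i I.
  have m0 : 0 < (m.+1%:R^-1 : R) by rewrite invr_gt0.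
  exists (diff_quot F (m.+1%:R^-1 / 2) x).
  apply/nbhs_ballP; exists (m.+1%:R^-1) => //= h.
  rewrite /ball /= sub0r normrN => hm h0.
  change (@ball _ ('cV[R]_k : normedModType R) (diff_quot F (m.+1%:R^-1 / 2) x)
    e (diff_quot F h x)).
  rewrite -ball_normE /=.
  apply: le_lt_trans ie; apply: Hm.
    by rewrite ger0_norm ?divr_ge0 ?(ltW m0)// divr_gt0//= ltr_pdivrMr// ltr_pMr// ltr1n.
  by rewrite hm andbT normr_gt0.
Qed.

Lemma diff_quot_continuous F h : continuous F -> continuous (diff_quot F h).
Proof.
move=> cF x; apply: cvgZr; apply: cvgB; last exact: cF.
by apply: continuous_comp; [apply: cvgD; [exact: cvg_cst|exact: cvg_id]|exact: cF].
Qed.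

Lemma quot_cauchy_closed F e d : continuous F -> closed (quot_cauchy F e d).
Proof.
move=> cF.
have -> : quot_cauchy F e d = \bigcap_(ab in [set ab : R * R |
    0 < `|ab.1| < d /\ 0 < `|ab.2| < d])
    [set x | `|diff_quot F ab.1 x - diff_quot F ab.2 x| <= e].
  apply/seteqP; split => x /= H; first by move=> [a b] /= [? ?]; exact: H.
  by move=> a b ? ?; exact: (H (a, b)).
apply: closed_bigI => -[a b] _ /=.
apply: (@preimage_closed _ _ (fun x => `|diff_quot F a x - diff_quot F b x|)
  [set y | y <= e]); last exact: closed_le.
move=> x _; apply: cvg_norm; apply: cvgB; exact: diff_quot_continuous.
Qed.

Lemma measurable_derivable F : continuous F ->
  measurable [set x | derivable F x 1].
Proof.
move=> cF; rewrite (_ : [set x | _] =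
  \bigcap_k \bigcup_m quot_cauchy F (k.+1%:R^-1) (m.+1%:R^-1)); last first.
  by apply/seteqP; split => x /derivable_quot_cauchyP.
apply: bigcapT_measurable => i; apply: bigcup_measurable => m _.
apply: closed_measurable; exact: quot_cauchy_closed.
Qed.

(* Where the derivative does not exist, [derive1] is the default point of the
   space of columns. *)
Lemma measurable_derive1 F (i : 'I_k) : continuous F ->
  measurable_fun setT (fun x => (derive1 F x) i 0).
Proof.
move=> cF; set D := [set x | derivable F x 1].
have mD : measurable D by exact: measurable_derivable.
pose c : R := (point : 'cV[R]_k) i 0.
pose f (m : nat) x : R :=
  diff_quot F (m.+1%:R^-1) x i 0 * \1_D x + c * \1_(~` D) x.
apply: (@measurable_fun_cvg _ _ _ _ f).
  move=> m; apply: measurable_funD; apply: measurable_funM => //.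
  - apply: continuous_measurable_fun => x.
    apply: (@continuous_comp _ _ _ (diff_quot F m.+1%:R^-1)
      (fun M : 'cV[R]_k => M i 0)); first exact: diff_quot_continuous.
    exact: coord_continuous.
  - by apply: measurable_indic; exact: measurableC.
move=> x _; rewrite /f !indicE; have [Dx|Dx] := pselect (D x).
- rewrite mem_set// memNset; last by move=> /(_ Dx).
  under eq_fun do rewrite mulr1 mulr0 addr0.
  have /derivable1E Fx : derivable F x 1 := Dx.
  have {}Fx : diff_quot F h x @[h --> 0^'] --> derive1 F x by exact: Fx.
  apply: (@cvg_comp _ _ _ (fun m : nat => diff_quot F m.+1%:R^-1 x)
    (fun M : 'cV[R]_k => M i 0) _ (nbhs (derive1 F x))); last exact: coord_continuous.
  apply: (cvg_comp _ _ _ Fx).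
  move=> A [d /= d0 Ad].
  have [N _ HN] := @near_infty_natSinv_lt R (PosNum d0).
  exists N => // m /= Nm; apply: Ad; last by rewrite invr_neq0// pnatr_eq0.
  rewrite /ball /= sub0r normrN ger0_norm ?invr_ge0//.
  exact: HN.
- rewrite memNset// mem_set//.
  under eq_fun do rewrite mulr0 mulr1 add0r.
  have -> : derive1 F x = point.
    by apply: dvgP => Fx; apply: Dx; apply/derivable1E.
  exact: cvg_cst.
Qed.

Lemma derive1_lipschitz_le F (K : R) : 0 <= K ->
  (forall x y, `|F x - F y| <= K * `|x - y|) -> forall x,
  `|derive1 F x| <= K + `|point : 'cV[R]_k|.
Proof.
move=> K0 FK x; have [Fx|Fx] := pselect (cvg (diff_quot F h x @[h --> 0^'])).
  rewrite -[leLHS]addr0 lerD//.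
  have {}Fx : diff_quot F h x @[h --> 0^'] --> derive1 F x by exact: Fx.
  have {}Fx : `|diff_quot F h x| @[h --> 0^'] --> `|derive1 F x| by exact: cvg_norm.
  apply: (cvgr_to_le Fx); near=> h.
  have h0 : h != 0 by near: h; exact: nbhs_dnbhs_neq.
  rewrite /diff_quot normrZ normfV ler_pdivrMl ?normr_gt0// mulrC.
  by rewrite (le_trans (FK _ _))// addrK.
rewrite (_ : derive1 F x = point) ?lerDr//; exact: dvgP.
Unshelve. all: by end_near. Qed.

Definition clamp (x : R) : R := Num.max 0 (Num.min x 1).

Lemma clamp_itv x : clamp x \in `[0, 1].
Proof.
by rewrite in_itv /= /clamp le_max lexx ge_max ler01 /= ge_min lexx orbT.
Qed.

Lemma clamp_id x : x \in `[0, 1] -> clamp x = x.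
Proof.
by rewrite in_itv /= /clamp => /andP[x0 x1]; rewrite (min_idPl x1); apply/max_idPr.
Qed.

Lemma clamp_lipschitz x y : `|clamp x - clamp y| <= `|x - y|.
Proof.
rewrite /clamp /Num.max /Num.min ler_norml.
have := ler_norm (x - y); have := ler_norm (- (x - y)); rewrite normrN => h1 h2.
by do 4! [case: ifPn]; rewrite -?leNgt => *; apply/andP; split; lra.
Qed.

Lemma lipschitz_clamp F (K : R) : K.-lipschitz_`[0, 1] F ->
  forall x y, `|F (clamp x) - F (clamp y)| <= `|K| * `|x - y|.
Proof.
move=> FK x y; have /= := FK (clamp x, clamp y).
move=> /(_ (conj (clamp_itv x) (clamp_itv y))) /le_trans; apply.
rewrite (le_trans (ler_wpM2r _ (ler_norm K)))// ler_wpM2l//.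
exact: clamp_lipschitz.
Qed.

Lemma lipschitz_continuous F (K : R) :
  (forall x y, `|F x - F y| <= K * `|x - y|) -> continuous F.
Proof.
move=> FK x; apply/cvgrPdist_le => /= e e0.
have K1 : 0 < `|K| + 1 by rewrite ltr_wpDl.
apply/nbhs_ballP; exists (e / (`|K| + 1)) => /=; first by rewrite divr_gt0.
move=> y; rewrite /ball /= ltr_pdivlMr// => xy.
rewrite (le_trans (FK x y))// (le_trans _ (ltW xy))// mulrC ler_wpM2l//.
by rewrite (le_trans (ler_norm K))// lerDl.
Qed.

Lemma derive1_clamp F x : x \in `]0, 1[ ->
  derive1 (F \o clamp) x = derive1 F x.
Proof.
move=> x01; rewrite !derive1E; apply: near_eq_derive.
near=> y => /=; rewrite clamp_id//; apply: subset_itv_oo_cc.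
by near: y; exact: near_in_itvoo.
Unshelve. all: by end_near. Qed.

Lemma integrable_path_derive1 F (K : R) (s : 'cV[R]_k -> R) (i : 'I_k) :
  K.-lipschitz_`[0, 1] F ->
  (forall x, x \in `[0, 1] -> {for F x, continuous s}) ->
  (@lebesgue_measure R).-integrable `[0, 1]
    (EFin \o (fun x => s (F x) * (derive1 F x) i 0)).
Proof.
move=> FK cs; have FcK := lipschitz_clamp FK.
have cF : continuous (F \o clamp) by apply: lipschitz_continuous FcK.
have csF : continuous (s \o (F \o clamp)).
  by move=> x; apply: continuous_comp; [exact: cF|apply: cs; exact: clamp_itv].
apply: measurable_bounded_integrable => //.
- by apply: compact_finite_measure; exact: segment_compact.
- apply/measurable_fun_itv_obnd_cbndP/measurable_fun_itv_bndo_bndcP.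
  apply: (eq_measurable_fun (fun x => s (F (clamp x)) * (derive1 (F \o clamp) x) i 0)).
    move=> x; rewrite inE => x01; rewrite derive1_clamp// clamp_id//.
    exact: subset_itv_oo_cc.
  apply: measurable_funTS; apply: measurable_funM.
    exact: continuous_measurable_fun.
  exact: measurable_derive1.
- have [c c01 sc] := @EVT_max R (fun x => `|s (F (clamp x))|) 0 1 ler01
    (continuous_subspaceT (fun x => cvg_norm (csF x))).
  pose B : R := `|K| + `|point : 'cV[R]_k| + `|derive1 F 0| + `|derive1 F 1|.
  have dB x : x \in `[0, 1] -> `|derive1 F x i 0| <= B.
    move=> x01; apply: (le_trans (entry_le_norm _ _ _)).
    have p0 := normr_ge0 (point : 'cV[R]_k).
    have [K0 d00 d10] : [/\ 0 <= `|K|, 0 <= `|derive1 F 0| & 0 <= `|derive1 F 1| ] by [].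
    have [->|x0] := eqVneq x 0; first by rewrite /B; lra.
    have [->|x1] := eqVneq x 1; first by rewrite /B; lra.
    have x01' : x \in `]0, 1[.
      by move: x01; rewrite !in_itv /= !lt_neqAle x1 eq_sym x0.
    rewrite -derive1_clamp//.
    have := derive1_lipschitz_le (normr_ge0 K) FcK x; rewrite /B; lra.
  exists (`|s (F (clamp c))| * B); split; first by rewrite num_real.
  move=> M BM x /= x01; apply: le_trans (ltW BM).
  rewrite normrM ler_pM//; last exact: dB.
  by have := sc _ x01; rewrite clamp_id.
Qed.
End PathDerivative.

Lemma cvg_sum (R : realType) (T : Type) (F : set_system T) {FF : Filter F} (I : Type) (s : seq I)
    (f : I -> T -> R) (l : I -> R) :
  (forall i, f i x @[x --> F] --> l i) ->
  \sum_(i <- s) f i x @[x --> F] --> \sum_(i <- s) l i.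
Proof.
move=> fl; elim: s => [|i s IH].
  by under eq_fun do rewrite big_nil; rewrite big_nil; exact: cvg_cst.
under eq_fun do rewrite big_cons; rewrite big_cons.
exact: cvgD.
Qed.

Section SigmaMax.
Context {R : realType} {k : nat}.
Implicit Types (A : 'M[R]_k.+1) (x y : 'rV[R]_k.+1).

Definition quad A x : R := (x *m A *m x^T) 0 0.

Lemma sqr_sumE x : (x *m x^T) 0 0 = \sum_i x 0 i ^+ 2.
Proof. by rewrite mxE; apply: eq_bigr => i _; rewrite mxE expr2. Qed.

Lemma quad_sumE A x : quad A x = \sum_i \sum_j x 0 i * A i j * x 0 j.
Proof.
rewrite /quad mxE exchange_big /=; apply: eq_bigr => j _.
by rewrite !mxE mulr_suml.
Qed.

Lemma quad1E x : quad 1%:M x = (x *m x^T) 0 0.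
Proof. by rewrite /quad mulmx1. Qed.

Lemma quad_scalar A (c : R) x : quad A (c *: x) = c ^+ 2 * quad A x.
Proof. by rewrite /quad linearZ /= -scalemxAr -!scalemxAl !mxE expr2 mulrA. Qed.

Lemma quad_continuous A : continuous (quad A).
Proof.
move=> x.
rewrite (_ : quad A = fun x => \sum_i \sum_j x 0 i * A i j * x 0 j); last first.
  by apply/funext => y; rewrite quad_sumE.
have FF : Filter (nbhs (x : 'rV[R]_k.+1)) by exact: nbhs_filter.
apply: (@cvg_sum _ _ _ FF) => i; apply: (@cvg_sum _ _ _ FF) => j.
apply: cvgM; last exact: coord_continuous.
by apply: cvgMl; exact: coord_continuous.
Qed.

Lemma sqr_gt0 x : x != 0 -> 0 < (x *m x^T) 0 0.
Proof.
move=> x0; rewrite sqr_sumE lt_neqAle eq_sym psumr_neq0; last first.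
  by move=> i _; exact: sqr_ge0.
have /rV0Pn[i xi] := x0.
rewrite sumr_ge0 ?andbT; last by move=> j _; exact: sqr_ge0.
by apply/hasP; exists i; rewrite ?mem_index_enum//= exprn_even_gt0.
Qed.

Lemma sphere_compact : compact [set x : 'rV[R]_k.+1 | (x *m x^T) 0 0 = 1].
Proof.
apply: bounded_closed_compact.
  exists 1; split; first by rewrite num_real.
  move=> M M1 x /= x1; apply: le_trans (ltW M1).
  rewrite [leLHS]mx_normrE; apply: bigmax_le => // -[i j] _ /=.
  rewrite (ord1 i) -(@expr_le1 _ 2)// real_normK ?num_real// -x1 sqr_sumE (bigD1 j)//= lerDl.
  by apply: sumr_ge0 => ? _; exact: sqr_ge0.
have -> : [set x : 'rV[R]_k.+1 | (x *m x^T) 0 0 = 1] = quad 1%:M @^-1` [set 1].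
  by apply/seteqP; split=> x; rewrite /= quad1E.
apply: preimage_closed; first by move=> x _; exact: quad_continuous.
exact: closed_eq.
Qed.

(* The maximum of the Rayleigh quotient is attained, hence is an eigenvalue. *)
Lemma rayleigh_max A : A^T = A -> exists2 a : R, eigenvalue A a &
  forall x, quad A x <= a * (x *m x^T) 0 0.
Proof.
move=> As.
pose S := [set x : 'rV[R]_k.+1 | (x *m x^T) 0 0 = 1].
have e1 : S (delta_mx 0 0).
  by rewrite /S /= trmx_delta mul_delta_mx mxE !eqxx.
have S0 : S !=set0 by exists (delta_mx 0 0).
have [c Sc Hc] := @EVT_max_rV R _ (quad A) S S0 sphere_compact
  (continuous_subspaceT (@quad_continuous A)).
pose a := quad A c.
have max x : quad A x <= a * (x *m x^T) 0 0.
  have [->|x0] := eqVneq x 0; first by rewrite /quad !mul0mx mxE mulr0.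
  have s0 := sqr_gt0 x0.
  pose r := (Num.sqrt ((x *m x^T) 0 0))^-1.
  have r2 : r ^+ 2 * (x *m x^T) 0 0 = 1.
    by rewrite exprVn sqr_sqrtr ?ltW// mulVf// gt_eqF.
  have Sr : S (r *: x) by rewrite /S /= -quad1E quad_scalar quad1E.
  have := Hc _ (mem_set Sr); rewrite quad_scalar -/a => H.
  by rewrite -[leLHS]mul1r -r2 mulrAC ler_wpM2r // ltW.
exists a => //; apply/eigenvalueP; exists c; last first.
  apply/eqP => c0; move: Sc => /set_mem; rewrite /S /= c0 mul0mx mxE => /esym/eqP.
  by rewrite oner_eq0.
apply/eqP; rewrite -subr_eq0.
pose N := A - a%:M.
have -> : c *m A - a *: c = c *m N by rewrite mulmxBr mul_mx_scalar.
apply: contraT => y0.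
set y := c *m N in y0 *.
have Ns : N^T = N by rewrite linearB /= As tr_scalar_mx.
have qN x : quad N x = quad A x - a * (x *m x^T) 0 0.
  by rewrite /quad mulmxBr mulmxBl mul_mx_scalar -scalemxAl !mxE.
have qNle x : quad N x <= 0 by rewrite qN subr_le0.
have qNc : quad N c = 0.
  by move: Sc => /set_mem Sc; rewrite qN Sc mulr1 subrr.
clearbody N.
have qNt t : quad N (c + t *: y) = 2 * t * (y *m y^T) 0 0 + t ^+ 2 * quad N y.
  rewrite -[RHS]add0r -qNc /quad [(c + t *: y)^T]linearD /= [(_ *: _)^T]linearZ /= !mulmxDl !mulmxDr.
  rewrite -!scalemxAl -!scalemxAr -/y.
  have -> : y *m N *m c^T = y *m y^T.
    by rewrite /y [in RHS]trmx_mul Ns mulmxA.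
  by rewrite !mxE; ring.
have s0 := sqr_gt0 y0.
pose q := quad N y; have q0 : q <= 0 := qNle y.
pose r := (y *m y^T) 0 0 / (1 - q).
have r0 : 0 < r by rewrite divr_gt0//; lra.
have rs : r * (1 - q) = (y *m y^T) 0 0.
  by rewrite /r divfK// gt_eqF// subr_gt0 (le_lt_trans q0).
have := qNle (c + r *: y); rewrite qNt -/q -rs.
move: r0 q0; clear; nra.
Qed.

Lemma sigma_max_rayleigh A (d : 'cV[R]_k.+1) : A^T = A ->
  (d^T *m A *m d) 0 0 <= sigma_max A * dotv d d.
Proof.
move=> /rayleigh_max[a aA aq].
have -> : sigma_max A = a.
  apply/eqP; rewrite eq_le; apply/andP; split.
    apply: sup_le_ub; first by exists a.
    move=> b /eigenvalueP[v vA v0]; have := aq v.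
    by rewrite /quad vA -scalemxAl [X in X <= _]mxE ler_pM2r// sqr_gt0.
  apply: ub_le_sup => //; exists a => b /eigenvalueP[v vA v0]; have := aq v.
  by rewrite /quad vA -scalemxAl [X in X <= _]mxE ler_pM2r// sqr_gt0.
by have := aq d^T; rewrite /quad trmxK.
Qed.
End SigmaMax.

Section Integration.
Context {R : realType}.
Implicit Types (f g F : R -> R) (a b : R).

Definition itv_integrable a b f :=
  (@lebesgue_measure R).-integrable `[a, b] (EFin \o f).

Lemma continuous_itv_integrable a b f :
  (forall t, t \in `[a, b] -> {for t, continuous f}) -> itv_integrable a b f.
Proof.
move=> cf; apply: continuous_compact_integrable; first exact: segment_compact.
by apply: continuous_in_subspaceT => t /set_mem; exact: cf.
Qed.

Lemma eq_Lint a b f g : {in `[a, b], f =1 g} -> Lint a b f = Lint a b g.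
Proof. by move=> fg; apply: eq_Rintegral => t /set_mem; exact: fg. Qed.

Lemma LintD a b f g : itv_integrable a b f -> itv_integrable a b g ->
  Lint a b (fun t => f t + g t) = Lint a b f + Lint a b g.
Proof. by move=> fi gi; rewrite /Lint RintegralD. Qed.

Lemma LintB a b f g : itv_integrable a b f -> itv_integrable a b g ->
  Lint a b (fun t => f t - g t) = Lint a b f - Lint a b g.
Proof. by move=> fi gi; rewrite /Lint RintegralB. Qed.

Lemma LintZl a b f c : itv_integrable a b f ->
  Lint a b (fun t => c * f t) = c * Lint a b f.
Proof. by move=> fi; rewrite /Lint RintegralZl. Qed.

Lemma itv_integrableZl a b f c : itv_integrable a b f ->
  itv_integrable a b (fun t => c * f t).
Proof.
move=> fi; rewrite /itv_integrable.
rewrite (_ : _ \o _ = fun x => (c%:E * (f x)%:E)%E)//.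
exact: integrableZl.
Qed.

Lemma itv_integrable_sum a b n (f : 'I_n -> R -> R) :
  (forall i, itv_integrable a b (f i)) ->
  itv_integrable a b (fun t => \sum_i f i t).
Proof.
move=> fi; rewrite /itv_integrable.
rewrite (_ : _ \o _ = fun x => (\sum_i (f i x)%:E)%E); last first.
  by apply/funext => x /=; rewrite sumEFin.
by apply: integrable_sum => // i _; exact: fi.
Qed.

Lemma Lint_sum a b n (f : 'I_n -> R -> R) : 
  (forall i, itv_integrable a b (f i)) ->
  Lint a b (fun t => \sum_i f i t) = \sum_i Lint a b (f i).
Proof.
elim: n f => [|n IH] f fi.
  rewrite big_ord0 -[RHS](_ : Lint a b (fun=> 0) = 0).
    by apply: eq_Lint => t _; rewrite big_ord0.
  by rewrite /Lint Rintegral_cst// mul0r.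
rewrite big_ord_recl -IH; last by move=> i; exact: fi.
rewrite -LintD//; last by apply: itv_integrable_sum => i; exact: fi.
by apply: eq_Lint => t _; rewrite big_ord_recl.
Qed.

Lemma Lint_FTC a b f F : a <= b ->
  (forall t, t \in `[a, b] -> {for t, continuous f}) ->
  (forall t, t \in `[a, b] -> is_derive t 1 F (f t)) ->
  Lint a b f = F b - F a.
Proof.
rewrite le_eqVlt => /orP[/eqP <-|ab] cf dF.
  by rewrite subrr /Lint set_itv1 Rintegral_set1.
have cF t : t \in `[a, b] -> {for t, continuous F}.
  by move=> /dF ?; apply/differentiable_continuous/derivable1_diffP.
rewrite /Lint /Rintegral (continuous_FTC2 ab (F := F))//.
- by apply: continuous_in_subspaceT => t /set_mem; exact: cf.
- split.
  + by move=> t /subset_itv_oo_cc /dF ?.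
  + by apply: cvg_at_right_filter; apply: cF; rewrite in_itv/= lexx ltW.
  + by apply: cvg_at_left_filter; apply: cF; rewrite in_itv/= lexx ltW.
- by move=> t /subset_itv_oo_cc /dF ?; rewrite derive1E derive_val.
Qed.
End Integration.

Section OneVariable.
Context {R : realType}.
Implicit Types (f g : R -> R) (t : R).

Lemma isdD f g t df dg : is_derive t 1 f df -> is_derive t 1 g dg ->
  is_derive t 1 (fun x => f x + g x) (df + dg).
Proof. by move=> ? ?; exact: is_deriveD. Qed.

Lemma isdN f t df : is_derive t 1 f df -> is_derive t 1 (fun x => - f x) (- df).
Proof. by move=> ?; exact: is_deriveN. Qed.

Lemma isdB f g t df dg : is_derive t 1 f df -> is_derive t 1 g dg ->
  is_derive t 1 (fun x => f x - g x) (df - dg).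
Proof. by move=> ? ?; exact: is_deriveB. Qed.

Lemma isd_cst (c : R) t : is_derive t 1 (fun _ : R => c) 0.
Proof. exact: is_derive_cst. Qed.

Lemma isdM f g t df dg : is_derive t 1 f df -> is_derive t 1 g dg ->
  is_derive t 1 (fun x => f x * g x) (df * g t + f t * dg).
Proof.
move=> ? ?; apply: is_derive_eq (is_deriveM _ _) _.
by rewrite /GRing.scale /= addrC mulrC.
Qed.

Lemma isdZ (c : R) f t df : is_derive t 1 f df ->
  is_derive t 1 (fun x => c * f x) (c * df).
Proof. by move=> ?; exact: is_deriveZ. Qed.

Lemma isdMr f (c : R) t df : is_derive t 1 f df ->
  is_derive t 1 (fun x => f x * c) (df * c).
Proof.
by move=> df'; apply: is_derive_eq (isdM df' (isd_cst c t)) _; rewrite mulr0 addr0.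
Qed.

Lemma isdBl f (c : R) t df : is_derive t 1 f df ->
  is_derive t 1 (fun x => c - f x) (- df).
Proof.
by move=> df'; apply: is_derive_eq (isdB (isd_cst c t) df') _; rewrite sub0r.
Qed.

Lemma isdV f t df : f t != 0 -> is_derive t 1 f df ->
  is_derive t 1 (fun x => (f x)^-1) (- df / f t ^+ 2).
Proof.
move=> f0 ?; apply: is_derive_eq (is_deriveV _ _) _ => //.
by rewrite /GRing.scale /= mulrC mulNr mulrN.
Qed.

Lemma isd_ln f t df : 0 < f t -> is_derive t 1 f df ->
  is_derive t 1 (fun x => ln (f x)) (df / f t).
Proof.
move=> f0 ?.
have ? := is_derive1_ln f0.
apply: is_derive_eq (@is_derive1_comp _ (@ln R) f t _ _ _ _) _.
by rewrite mulrC.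
Qed.

Lemma isd_sum n (f : 'I_n -> R -> R) t (df : 'I_n -> R) :
  (forall i, is_derive t 1 (f i) (df i)) ->
  is_derive t 1 (fun x => \sum_i f i x) (\sum_i df i).
Proof.
move=> fi; rewrite (_ : (fun x => _) = \sum_i f i); last first.
  by apply/funext => x; rewrite fct_sumE.
exact: is_derive_sum.
Qed.

Lemma isd_affine (a b : R) t : is_derive t 1 (fun x => a + x * b) b.
Proof.
apply: is_derive_eq (isdD (isd_cst a t) (isdM (is_derive_id t 1) (isd_cst b t))) _.
by rewrite mul1r mulr0 add0r addr0.
Qed.

Lemma isd_continuous f t df : is_derive t 1 f df -> {for t, continuous f}.
Proof. by move=> ?; apply/differentiable_continuous/derivable1_diffP. Qed.

Lemma dotvE n (x y : 'cV[R]_n) : dotv x y = \sum_i x i 0 * y i 0.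
Proof. by rewrite /dotv mxE; apply: eq_bigr => i _; rewrite mxE. Qed.

Lemma isd_dotv n (x y : R -> 'cV[R]_n) (dx dy : 'cV[R]_n) t :
  (forall i, is_derive t 1 (fun s => x s i 0) (dx i 0)) ->
  (forall i, is_derive t 1 (fun s => y s i 0) (dy i 0)) ->
  is_derive t 1 (fun s => dotv (x s) (y s)) (dotv dx (y t) + dotv (x t) dy).
Proof.
move=> Hx Hy.
rewrite (_ : (fun s => _) = fun s => \sum_i x s i 0 * y s i 0); last first.
  by apply/funext => s; rewrite dotvE.
apply: is_derive_eq (isd_sum (fun i => isdM (Hx i) (Hy i))) _.
by rewrite big_split /= !dotvE.
Qed.

Lemma isd_dotvr n (x : R -> 'cV[R]_n) (c dx : 'cV[R]_n) t :
  (forall i, is_derive t 1 (fun s => x s i 0) (dx i 0)) ->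
  is_derive t 1 (fun s => dotv (x s) c) (dotv dx c).
Proof.
move=> Hx; rewrite (_ : (fun s => _) = fun s => \sum_i x s i 0 * c i 0); last first.
  by apply/funext => s; rewrite dotvE.
by rewrite dotvE; apply: isd_sum => i; exact: isdMr.
Qed.

End OneVariable.

Section DotProduct.
Context {R : realType} {k : nat}.
Implicit Types x y z : 'cV[R]_k.

Lemma dotvC x y : dotv x y = dotv y x.
Proof. by rewrite !dotvE; apply: eq_bigr => i _; rewrite mulrC. Qed.

Lemma dotvDl x y z : dotv (x + y) z = dotv x z + dotv y z.
Proof. by rewrite /dotv linearD /= mulmxDl mxE. Qed.

Lemma dotvNl x z : dotv (- x) z = - dotv x z.
Proof. by rewrite /dotv linearN /= mulNmx mxE. Qed.

Lemma dotvZl (a : R) x z : dotv (a *: x) z = a * dotv x z.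
Proof. by rewrite /dotv linearZ /= -scalemxAl mxE. Qed.

Lemma dotvDr x y z : dotv x (y + z) = dotv x y + dotv x z.
Proof. by rewrite dotvC dotvDl !(dotvC x). Qed.

Lemma dotvNr x z : dotv x (- z) = - dotv x z.
Proof. by rewrite dotvC dotvNl dotvC. Qed.

Lemma dotvZr (a : R) x z : dotv x (a *: z) = a * dotv x z.
Proof. by rewrite dotvC dotvZl dotvC. Qed.

Definition dotvP := (dotvDl, dotvDr, dotvNl, dotvNr, dotvZl, dotvZr).

Lemma dotv_ge0 x : 0 <= dotv x x.
Proof. by rewrite dotvE; apply: sumr_ge0 => i _; rewrite -expr2 sqr_ge0. Qed.

Lemma dotv_gt0 x : x != 0 -> 0 < dotv x x.
Proof.
move=> /cV0Pn[i xi]; rewrite dotvE (bigD1 i)//= ltr_pwDl//.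
  by rewrite -expr2 exprn_even_gt0.
by apply: sumr_ge0 => j _; rewrite -expr2 sqr_ge0.
Qed.

Lemma sqr_norm2 x : norm2 x ^+ 2 = dotv x x.
Proof. by rewrite /norm2 sqr_sqrtr// dotv_ge0. Qed.

Lemma dotv_delta x i : dotv x (delta_mx i 0) = x i 0.
Proof.
rewrite dotvE (bigD1 i)//= mxE !eqxx mulr1 big1 ?addr0// => j ji.
by rewrite mxE (negPf ji) mulr0.
Qed.

Lemma linear_deltaE (f : 'cV[R]_k -> R) x :
  (forall a y z, f (a *: y + z) = a * f y + f z) ->
  f x = \sum_j x j 0 * f (delta_mx j 0).
Proof.
move=> fL; have f0 : f 0 = 0.
  by have := fL 1 0 0; rewrite scaler0 addr0 mul1r => H; apply: (addrI (f 0)); rewrite addr0 -H.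
rewrite [in LHS](matrix_sum_delta x).
under eq_bigr do rewrite big_ord1.
elim/big_rec2 : _ => [//|i y z _ <-]; exact: fL.
Qed.

End DotProduct.

Section MHDDerivatives.
Context {R : realType} {n : nat}.
Implicit Types (U v w d : state R n) (t : R).

Lemma gam_gt1 : 1 < gam :> R. Proof. by rewrite /gam; lra. Qed.

Lemma gamB1_gt0 : 0 < gam - 1 :> R. Proof. by rewrite subr_gt0 gam_gt1. Qed.

Lemma gamB1_neq0 : gam - 1 != 0 :> R. Proof. by rewrite gt_eqF// gamB1_gt0. Qed.

Lemma rho_linear a U v : rho (a *: U + v) = a * rho U + rho v.
Proof. by rewrite /rho !mxE. Qed.

Lemma energy_linear a U v : energy (a *: U + v) = a * energy U + energy v.
Proof. by rewrite /energy !mxE. Qed.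

Lemma mom_linear a U v : mom (a *: U + v) = a *: mom U + mom v.
Proof. by apply/matrixP => i j; rewrite !mxE. Qed.

Lemma mag_linear a U v : mag (a *: U + v) = a *: mag U + mag v.
Proof. by apply/matrixP => i j; rewrite !mxE. Qed.

Lemma rho_line U v t : rho (U + t *: v) = rho U + t * rho v.
Proof. by rewrite addrC rho_linear addrC. Qed.

Lemma energy_line U v t : energy (U + t *: v) = energy U + t * energy v.
Proof. by rewrite addrC energy_linear addrC. Qed.

Lemma mom_line U v t : mom (U + t *: v) = mom U + t *: mom v.
Proof. by rewrite addrC mom_linear addrC. Qed.

Lemma mag_line U v t : mag (U + t *: v) = mag U + t *: mag v.
Proof. by rewrite addrC mag_linear addrC. Qed.

Lemma pressureE U : pressure U = (gam - 1) *
  (energy U - 2^-1 * (rho U * dotv (vel U) (vel U)) - 2^-1 * dotv (mag U) (mag U)).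
Proof. by rewrite /pressure !sqr_norm2 mulrA. Qed.

Lemma spec_entropyE U : G U ->
  spec_entropy U = ln (pressure U) - gam * ln (rho U).
Proof.
by move=> [r0 p0]; rewrite /spec_entropy lnM ?posrE ?powR_gt0// ln_powR mulNr.
Qed.

Definition dvel U v : 'cV[R]_n.+1 := (rho U)^-1 *: (mom v - rho v *: vel U).

(* The pressure has differential (gam - 1) * dinternal. *)
Definition dinternal U v : R :=
  energy v - rho U * dotv (vel U) (dvel U v)
  - 2^-1 * (rho v * dotv (vel U) (vel U)) - dotv (mag U) (mag v).

Definition dspec U v : R :=
  (gam - 1) * dinternal U v / pressure U - gam * (rho v / rho U).

Definition dentropy U v : R :=
  (gam - spec_entropy U) * rho v / (gam - 1)
  - rho U / pressure U * dinternal U v.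

Definition d2entropy U v w : R :=
  - (rho v * dspec U w) / (gam - 1)
  - (rho w / pressure U
     - rho U * ((gam - 1) * dinternal U w) / pressure U ^+ 2) * dinternal U v
  + rho U / pressure U *
    (rho U * dotv (dvel U v) (dvel U w) + dotv (mag v) (mag w)).

Lemma isd_rho U v t : is_derive t 1 (fun s => rho (U + s *: v)) (rho v).
Proof. by under eq_fun do rewrite rho_line; exact: isd_affine. Qed.

Lemma isd_energy U v t : is_derive t 1 (fun s => energy (U + s *: v)) (energy v).
Proof. by under eq_fun do rewrite energy_line; exact: isd_affine. Qed.

Lemma isd_mom U v t i : is_derive t 1 (fun s => mom (U + s *: v) i 0) (mom v i 0).
Proof.
rewrite (_ : (fun s => _) = fun s => mom U i 0 + s * mom v i 0); first exact: isd_affine.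
by apply/funext => s; rewrite mom_line !mxE.
Qed.

Lemma isd_mag U v t i : is_derive t 1 (fun s => mag (U + s *: v) i 0) (mag v i 0).
Proof.
rewrite (_ : (fun s => _) = fun s => mag U i 0 + s * mag v i 0); first exact: isd_affine.
by apply/funext => s; rewrite mag_line !mxE.
Qed.

Lemma isd_vel U v t i : rho (U + t *: v) != 0 ->
  is_derive t 1 (fun s => vel (U + s *: v) i 0) (dvel (U + t *: v) v i 0).
Proof.
move=> r0.
rewrite (_ : (fun s => _) = fun s => (rho (U + s *: v))^-1 * mom (U + s *: v) i 0); last first.
  by apply/funext => s; rewrite /vel !mxE.
apply: is_derive_eq (isdM (isdV (f := fun s => rho (U + s *: v)) r0
  (isd_rho _ _ _)) (isd_mom _ _ _ _)) _.
move: r0; set W := U + t *: v => r0; rewrite /dvel /vel !mxE.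
by field.
Qed.

Lemma isd_pressure U v t : rho (U + t *: v) != 0 ->
  is_derive t 1 (fun s => pressure (U + s *: v))
    ((gam - 1) * dinternal (U + t *: v) v).
Proof.
move=> r0; under eq_fun do rewrite pressureE.
have dB := isd_mag U v t; have du i := isd_vel i r0.
apply: isdZ; apply: is_derive_eq (isdB (isdB (isd_energy U v t)
  (isdZ 2^-1 (isdM (isd_rho U v t) (isd_dotv du du)))) (isdZ 2^-1 (isd_dotv dB dB))) _.
rewrite /dinternal [dotv (dvel _ _) _]dotvC [dotv (mag v) _]dotvC.
by field.
Qed.

Lemma isd_spec_entropy U v t : G (U + t *: v) ->
  is_derive t 1 (fun s => spec_entropy (U + s *: v)) (dspec (U + t *: v) v).
Proof.
move=> GU; have [r0 p0] := GU; have r1 : rho (U + t *: v) != 0 by rewrite gt_eqF.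
apply: (@near_eq_is_derive R R R (fun s =>
  ln (pressure (U + s *: v)) - gam * ln (rho (U + s *: v)))).
  have cr := isd_continuous (isd_rho U v t).
  have cp := isd_continuous (isd_pressure r1).
  near=> s; rewrite spec_entropyE//; split; near: s.
    exact: (cvgr_gt _ cr).
  exact: (cvgr_gt _ cp).
exact: (isdB (isd_ln (f := fun s => pressure (U + s *: v)) p0 (isd_pressure r1))
  (isdZ gam (isd_ln (f := fun s => rho (U + s *: v)) r0 (isd_rho U v t)))).
Unshelve. all: by end_near. Qed.

Lemma isd_entropy U v t : G (U + t *: v) ->
  is_derive t 1 (fun s => entropy (U + s *: v)) (dentropy (U + t *: v) v).
Proof.
move=> GU; have [r0 p0] := GU; rewrite /entropy.
apply: is_derive_eq (isdMr (gam - 1)^-1 (isdN (isdM (isd_rho U v t) (isd_spec_entropy GU)))) _.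
rewrite /dentropy /dspec; move: (gam - 1) gamB1_neq0 (gt_eqF r0) (gt_eqF p0).
move=> g g0 /negbT r1 /negbT p1.
by field; rewrite g0 p1.
Qed.

Lemma isd_dvel U v w t i : rho (U + t *: w) != 0 ->
  is_derive t 1 (fun s => dvel (U + s *: w) v i 0)
  ((- (rho (U + t *: w))^-1 *:
    (rho w *: dvel (U + t *: w) v + rho v *: dvel (U + t *: w) w)) i 0).
Proof.
move=> r0.
rewrite (_ : (fun s => _) = fun s => (rho (U + s *: w))^-1 *
   (mom v i 0 - rho v * vel (U + s *: w) i 0)); last first.
  by apply/funext => s; rewrite /dvel !mxE.
apply: is_derive_eq (isdM (isdV r0 (isd_rho U w t))
  (isdBl (mom v i 0) (isdZ (rho v) (isd_vel i r0)))) _.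
rewrite /dvel !mxE; set a := rho (U + t *: w) in r0 *.
by field.
Qed.

Lemma isd_dinternal U v w t : rho (U + t *: w) != 0 ->
  is_derive t 1 (fun s => dinternal (U + s *: w) v)
   (- (rho (U + t *: w) * dotv (dvel (U + t *: w) v) (dvel (U + t *: w) w)
       + dotv (mag v) (mag w))).
Proof.
move=> r0; rewrite /dinternal; have dB := isd_dotvr (mag v) (isd_mag U w t).
have du i := isd_vel i r0; have ddu i := isd_dvel v i r0.
apply: is_derive_eq (isdB (isdB (isdBl (energy v)
  (isdM (isd_rho U w t) (isd_dotv du ddu)))
  (isdZ 2^-1 (isdZ (rho v) (isd_dotv du du)))) dB) _.
set W := U + t *: w in r0 *.
rewrite !dotvP (dotvC (mag w)) !(dotvC (mom w)) (dotvC (mom v) (mom W)).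
by field.
Qed.

Lemma isd_dentropy U v w t : G (U + t *: w) ->
  is_derive t 1 (fun s => dentropy (U + s *: w) v) (d2entropy (U + t *: w) v w).
Proof.
move=> GU; have [r0 p0] := GU.
have r1 : rho (U + t *: w) != 0 by rewrite gt_eqF.
have p1 : pressure (U + t *: w) != 0 by rewrite gt_eqF.
rewrite /dentropy; apply: is_derive_eq (isdB
  (isdMr (gam - 1)^-1 (isdMr (rho v) (isdBl gam (isd_spec_entropy GU))))
  (isdM (isdM (isd_rho U w t) (isdV (f := fun s => pressure (U + s *: w)) p1
    (isd_pressure r1))) (isd_dinternal v r1))) _.
rewrite /d2entropy; move: (gam - 1) gamB1_neq0 r1 p1 => g g0 r1 p1.
by field; rewrite g0 p1.
Qed.

End MHDDerivatives.

Lemma dotv0l (R : realType) k (x : 'cV[R]_k) : dotv 0 x = 0.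
Proof. by rewrite /dotv trmx0 mul0mx mxE. Qed.

Section MHDAlgebra.
Context {R : realType} {n : nat}.
Implicit Types (U v w d : state R n) (t : R).

Lemma dvel_linear U a v w : dvel U (a *: v + w) = a *: dvel U v + dvel U w.
Proof.
rewrite /dvel rho_linear mom_linear; apply/matrixP => i j; rewrite !mxE; ring.
Qed.

Lemma dinternal_linear U a v w :
  dinternal U (a *: v + w) = a * dinternal U v + dinternal U w.
Proof.
by rewrite /dinternal energy_linear dvel_linear rho_linear mag_linear !dotvP; ring.
Qed.

Lemma dentropy_linear U a v w :
  dentropy U (a *: v + w) = a * dentropy U v + dentropy U w.
Proof. by rewrite /dentropy dinternal_linear rho_linear; ring. Qed.

Lemma d2entropyC U v w : G U -> d2entropy U v w = d2entropy U w v.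
Proof.
move=> [/lt0r_neq0 r0 /lt0r_neq0 p0].
rewrite /d2entropy [dotv (dvel U v) _]dotvC [dotv (mag v) _]dotvC /dspec.
have g0 := @gamB1_neq0 R.
by field; rewrite r0 p0 g0.
Qed.

Lemma d2entropy_linear U a v w d :
  d2entropy U (a *: v + w) d = a * d2entropy U v d + d2entropy U w d.
Proof.
rewrite /d2entropy dinternal_linear dvel_linear rho_linear mag_linear !dotvP.
ring.
Qed.

Lemma state_eq0 U v : rho U != 0 -> rho v = 0 -> dvel U v = 0 -> mag v = 0 ->
  dinternal U v = 0 -> v = 0.
Proof.
move=> r0 rv uv Bv; rewrite /dinternal rv uv Bv !(dotvC _ 0).
rewrite !dotv0l !mul0r !mulr0 !subr0 => Ev.
have mv : mom v = 0.
  have /eqP := uv; rewrite /dvel rv scale0r subr0 scaler_eq0 invr_eq0 (negPf r0).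
  by move=> /eqP.
rewrite -[v]vsubmxK -[dsubmx v]vsubmxK -[dsubmx (dsubmx v)]vsubmxK.
rewrite -/(mom v) mv -/(mag v) Bv.
have -> : usubmx v = 0.
  by apply/matrixP => i j; rewrite !ord1 [RHS]mxE; exact: rv.
have -> : usubmx (dsubmx (dsubmx v)) = 0.
  by apply/matrixP => i j; rewrite !ord1 [RHS]mxE; exact: Ev.
by rewrite !col_mx0.
Qed.

Lemma d2entropy_gt0 U v : G U -> v != 0 -> 0 < d2entropy U v v.
Proof.
move=> [r0 p0] v0.
have p1 : pressure U != 0 by rewrite gt_eqF.
have r1 : rho U != 0 by rewrite gt_eqF.
have g0 := @gamB1_gt0 R; have g1 := @gamB1_neq0 R.
(* Completing the square in the variation of the density. *)
have -> : d2entropy U v v =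
  rho U / pressure U * (rho U * dotv (dvel U v) (dvel U v) + dotv (mag v) (mag v))
  + rho U * ((gam - 1) * dinternal U v / pressure U - rho v / rho U) ^+ 2 / (gam - 1)
  + rho v ^+ 2 / rho U.
  rewrite /d2entropy /dspec.
  by field; rewrite r1 p1 g1.
have q1 : 0 < rho U / pressure U by rewrite divr_gt0.
have H1 := dotv_ge0 (dvel U v); have H2 := dotv_ge0 (mag v).
have T1 : 0 <= rho U / pressure U * (rho U * dotv (dvel U v) (dvel U v) + dotv (mag v) (mag v)).
  by apply: mulr_ge0; [exact: ltW|apply: addr_ge0 => //; apply: mulr_ge0 => //; exact: ltW].
have T2 : 0 <= rho U * ((gam - 1) * dinternal U v / pressure U - rho v / rho U) ^+ 2 / (gam - 1).
  by apply: divr_ge0; [apply: mulr_ge0; [exact: ltW|exact: sqr_ge0]|exact: ltW].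
have T3 : 0 <= rho v ^+ 2 / rho U by apply: divr_ge0; [exact: sqr_ge0|exact: ltW].
have [rv|rv] := eqVneq (rho v) 0; last first.
  by rewrite ltr_wpDl ?addr_ge0// divr_gt0// exprn_even_gt0.
have [Bv|Bv] := eqVneq (mag v) 0; last first.
  rewrite -addrA ltr_wpDr ?addr_ge0// mulr_gt0// ltr_wpDl ?dotv_gt0//.
  by rewrite mulr_ge0// ltW.
have [uv|uv] := eqVneq (dvel U v) 0; last first.
  rewrite -addrA ltr_wpDr ?addr_ge0// mulr_gt0// ltr_wpDr//.
  by rewrite mulr_gt0// dotv_gt0.
have [qv|qv] := eqVneq (dinternal U v) 0.
  by move: v0; rewrite (state_eq0 r1 rv uv Bv qv) eqxx.
rewrite ltr_wpDr// ltr_wpDl// divr_gt0// mulr_gt0// rv mul0r subr0.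
by rewrite exprn_even_gt0//= !mulf_neq0// invr_neq0.
Qed.

Lemma entropy_fluxE U : entropy_flux U = entropy U * ux U.
Proof. by rewrite /entropy_flux /entropy; ring. Qed.

Definition dentropy_flux U v : R :=
  dentropy U v * ux U + entropy U * dvel U v 0 0.

Lemma isd_entropy_flux U v t : G (U + t *: v) ->
  is_derive t 1 (fun s => entropy_flux (U + s *: v)) (dentropy_flux (U + t *: v) v).
Proof.
move=> GU; under eq_fun do rewrite entropy_fluxE.
by apply: isdM; [exact: isd_entropy|apply: isd_vel; rewrite gt_eqF//; case: GU].
Qed.

Definition dpstar U v : R := (gam - 1) * dinternal U v + dotv (mag U) (mag v).

Definition dflux U v : state R n :=
  col_mx (rho v * ux U + rho U * dvel U v 0 0)%:M
 (col_mx ((rho v * ux U + rho U * dvel U v 0 0) *: vel U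
          + (rho U * ux U) *: dvel U v + dpstar U v *: delta_mx 0 0
          - (Bx v *: mag U + Bx U *: mag v))
 (col_mx (dvel U v 0 0 * (energy U + pstar U) + ux U * (energy v + dpstar U v)
          - (Bx v * dotv (vel U) (mag U)
             + Bx U * (dotv (dvel U v) (mag U) + dotv (vel U) (mag v))))%:M
         ((dvel U v 0 0 *: mag U + ux U *: mag v)
          - (Bx v *: vel U + Bx U *: dvel U v)))).

Lemma isd_pstar U v t : rho (U + t *: v) != 0 ->
  is_derive t 1 (fun s => pstar (U + s *: v)) (dpstar (U + t *: v) v).
Proof.
move=> r0; under eq_fun do rewrite /pstar sqr_norm2.
have dB := isd_mag U v t.
apply: is_derive_eq (isdD (isd_pressure r0) (isdZ 2^-1 (isd_dotv dB dB))) _.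
by rewrite /dpstar [dotv (mag v) _]dotvC; field.
Qed.

Lemma isd_flux U v t i : rho (U + t *: v) != 0 ->
  is_derive t 1 (fun s => flux (U + s *: v) i 0) (dflux (U + t *: v) v i 0).
Proof.
move=> r0; have du j := isd_vel j r0; have dB := isd_mag U v t.
have dr := isd_rho U v t; have dp := isd_pstar r0; have dE := isd_energy U v t.
have dub := isd_dotv du dB.
have ZE k (a : R) (x : 'cV[R]_k) j : (a *: x) j 0 = a * x j 0 by rewrite mxE.
have DE k (x y : 'cV[R]_k) j : (x + y) j 0 = x j 0 + y j 0 by rewrite mxE.
have NE k (x : 'cV[R]_k) j : (- x) j 0 = - x j 0 by rewrite mxE.
have ME (a : R) : (@scalar_mx R 1 a) 0 0 = a by rewrite mxE eqxx mulr1n.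
case: (split_ordP i) => j ->.
  rewrite (ord1 j); under eq_fun do rewrite /flux col_mxEu ME.
  by rewrite /dflux col_mxEu ME; exact: isdM dr (du 0).
case: (split_ordP j) => {}j ->.
  under eq_fun do rewrite /flux col_mxEd col_mxEu DE DE NE
    (ZE _ (rho _ * ux _)) (ZE _ (pstar _)) (ZE _ (Bx _)).
  rewrite /dflux col_mxEd col_mxEu; set W := U + t *: v.
  have -> : forall x y : 'cV[R]_n.+1, ((rho v * ux W + rho W * dvel W v 0 0) *: vel W
          + (rho W * ux W) *: dvel W v + dpstar W v *: x - y) j 0 =
    (rho v * ux W + rho W * dvel W v 0 0) * vel W j 0 + (rho W * ux W) * dvel W v j 0
     + dpstar W v * x j 0 - y j 0.
    by move=> x y; move: (vel W) (dvel W v) => ? ?; rewrite !(DE, NE, ZE).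
  rewrite DE (ZE _ (Bx v)) (ZE _ (Bx W)).
  by apply: is_derive_eq (isdB (isdD (isdM (isdM dr (du 0)) (du j))
    (isdMr (delta_mx 0 0 j 0) dp)) (isdM (dB 0) (dB j))) _; rewrite /ux /Bx; ring.
case: (split_ordP j) => {}j ->.
  rewrite (ord1 j); under eq_fun do rewrite /flux !col_mxEd col_mxEu ME.
  rewrite /dflux !col_mxEd col_mxEu ME.
  by apply: is_derive_eq (isdB (isdM (du 0) (isdD dE dp)) (isdM (dB 0) dub)) _.
under eq_fun do rewrite /flux !col_mxEd DE NE (ZE _ (ux _)) (ZE _ (Bx _)).
rewrite /dflux !col_mxEd; set W := U + t *: v.
rewrite DE NE !DE (ZE _ (dvel W v 0 0)) (ZE _ (ux W)) (ZE _ (Bx v)) (ZE _ (Bx W)).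
by apply: is_derive_eq (isdB (isdM (du 0) (dB j)) (isdM (dB 0) (du j))) _.
Qed.

Lemma rho_dflux U v : rho (dflux U v) = rho v * ux U + rho U * dvel U v 0 0.
Proof. by rewrite {1}/rho /dflux col_mxKu mxE eqxx mulr1n. Qed.

Lemma mom_dflux U v : mom (dflux U v) =
  (rho v * ux U + rho U * dvel U v 0 0) *: vel U
  + (rho U * ux U) *: dvel U v + dpstar U v *: delta_mx 0 0
  - (Bx v *: mag U + Bx U *: mag v).
Proof. by rewrite /mom /dflux col_mxKd col_mxKu. Qed.

Lemma dvel_dflux U v : rho U != 0 -> dvel U (dflux U v) =
  ux U *: dvel U v + (rho U)^-1 *:
    (dpstar U v *: delta_mx 0 0 - (Bx v *: mag U + Bx U *: mag v)).
Proof.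
move=> r0; rewrite {1}/dvel rho_dflux mom_dflux.
move: (dvel U v) (vel U) (mag U) (mag v) => x y z w.
have ZE k (a : R) (u : 'cV[R]_k) j : (a *: u) j 0 = a * u j 0 by rewrite mxE.
have DE k (u u' : 'cV[R]_k) j : (u + u') j 0 = u j 0 + u' j 0 by rewrite mxE.
have NE k (u : 'cV[R]_k) j : (- u) j 0 = - u j 0 by rewrite mxE.
by apply/matrixP => i j; rewrite ord1 !(ZE, DE, NE); field.
Qed.

Lemma dinternal_dflux U v : rho U != 0 -> dinternal U (dflux U v) =
  ux U * dinternal U v + gam * pressure U / (gam - 1) * dvel U v 0 0
  + Bx v * dotv (vel U) (mag U).
Proof.
move=> r0; have g0 := @gamB1_neq0 R.
have EE : energy U = pressure U / (gam - 1) +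
    2^-1 * (rho U * dotv (vel U) (vel U)) + 2^-1 * dotv (mag U) (mag U).
  by rewrite pressureE; field; exact: g0.
rewrite {1}/dinternal dvel_dflux//.
have -> : energy (dflux U v) = dvel U v 0 0 * (energy U + pstar U) + ux U * (energy v + dpstar U v)
          - (Bx v * dotv (vel U) (mag U)
             + Bx U * (dotv (dvel U v) (mag U) + dotv (vel U) (mag v))).
  by rewrite {1}/energy /dflux !col_mxKd col_mxKu mxE eqxx mulr1n.
rewrite rho_dflux.
have -> : mag (dflux U v) = (dvel U v 0 0 *: mag U + ux U *: mag v)
          - (Bx v *: vel U + Bx U *: dvel U v).
  by rewrite {1}/mag /dflux !col_mxKd.
rewrite EE /pstar sqr_norm2 /dinternal /dpstar /dinternal /ux /Bx.
move: (dvel U v) (vel U) (mag U) (mag v) => x y z w.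
rewrite !dotvP !dotv_delta [dotv z x]dotvC [dotv z y]dotvC.
by field; rewrite r0 g0.
Qed.

Lemma entropy_compatible U v : G U ->
  dentropy_flux U v =
  dentropy U (dflux U v) + rho U / pressure U * dotv (vel U) (mag U) * Bx v.
Proof.
move=> [/lt0r_neq0 r0 /lt0r_neq0 p0].
rewrite {1}/dentropy dinternal_dflux// rho_dflux.
rewrite /dentropy_flux /dentropy /entropy.
have g0 := @gamB1_neq0 R.
by field; rewrite p0 g0.
Qed.
End MHDAlgebra.

Section Continuity.
Context {R : realType}.
Context {T : topologicalType}.
Implicit Types (f g : T -> R) (x : T).

Lemma ctsE f g x : f =1 g -> {for x, continuous g} -> {for x, continuous f}.
Proof. by move=> /funext ->. Qed.

Lemma ctsD f g x : {for x, continuous f} -> {for x, continuous g} ->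
  {for x, continuous (fun y => f y + g y)}.
Proof. exact: cvgD. Qed.

Lemma ctsB f g x : {for x, continuous f} -> {for x, continuous g} ->
  {for x, continuous (fun y => f y - g y)}.
Proof. exact: cvgB. Qed.

Lemma ctsN f x : {for x, continuous f} -> {for x, continuous (fun y => - f y)}.
Proof. exact: cvgN. Qed.

Lemma ctsM f g x : {for x, continuous f} -> {for x, continuous g} ->
  {for x, continuous (fun y => f y * g y)}.
Proof. exact: cvgM. Qed.

Lemma ctsV f x : f x != 0 -> {for x, continuous f} ->
  {for x, continuous (fun y => (f y)^-1)}.
Proof. exact: cvgV. Qed.

Lemma ctsX f n x : {for x, continuous f} -> {for x, continuous (fun y => f y ^+ n)}.
Proof.
move=> cf; elim: n => [|n IH]; first exact: cvg_cst.
apply: (ctsE (g := fun y => f y * f y ^+ n)) => [y|]; first by rewrite exprS.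
exact: ctsM.
Qed.

Lemma cts_cst (c : R) x : {for x, continuous (fun _ : T => c)}.
Proof. exact: cvg_cst. Qed.

Lemma cts_dotv n (f g : T -> 'cV[R]_n) x :
  (forall i, {for x, continuous (fun y => f y i 0)}) ->
  (forall i, {for x, continuous (fun y => g y i 0)}) ->
  {for x, continuous (fun y => dotv (f y) (g y))}.
Proof.
move=> cf cg; apply: (ctsE (g := fun y => \sum_i f y i 0 * g y i 0)) => [y|].
  by rewrite dotvE.
by apply: cvg_sum => i; exact: ctsM.
Qed.

End Continuity.

Section MHDContinuity.
Context {R : realType} {n : nat}.
Implicit Types (U v w d : state R n) (t : R).

Lemma cts_rho U : {for U, continuous (@rho R n)}.
Proof.
apply: (ctsE (g := fun y : state R n => y (lshift _ 0) 0)) => [y|].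
  by rewrite /rho !mxE.
exact: coord_continuous.
Qed.

Lemma cts_energy U : {for U, continuous (@energy R n)}.
Proof.
apply: (ctsE (g := fun y : state R n => y (rshift 1 (rshift n.+1 (lshift _ 0))) 0)) => [y|].
  by rewrite /energy !mxE.
exact: coord_continuous.
Qed.

Lemma cts_mom U i : {for U, continuous (fun y : state R n => mom y i 0)}.
Proof.
apply: (ctsE (g := fun y : state R n => y (rshift 1 (lshift _ i)) 0)) => [y|].
  by rewrite /mom !mxE.
exact: coord_continuous.
Qed.

Lemma cts_mag U i : {for U, continuous (fun y : state R n => mag y i 0)}.
Proof.
apply: (ctsE (g := fun y : state R n => y (rshift 1 (rshift n.+1 (rshift 1 i))) 0)) => [y|].
  by rewrite /mag !mxE.
exact: coord_continuous.
Qed.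

Section AtState.
Variables (U : state R n) (GU : G U).

Let r0 : rho U != 0. Proof. by rewrite lt0r_neq0//; case: GU. Qed.
Let p0 : pressure U != 0. Proof. by rewrite lt0r_neq0//; case: GU. Qed.

Lemma cts_invrho : {for U, continuous (fun y : state R n => (rho y)^-1)}.
Proof. by apply: ctsV => //; exact: cts_rho. Qed.

Lemma cts_vel i : {for U, continuous (fun y : state R n => vel y i 0)}.
Proof.
apply: (ctsE (g := fun y : state R n => (rho y)^-1 * mom y i 0)) => [y|].
  by rewrite /vel mxE.
by apply: ctsM; [exact: cts_invrho|exact: cts_mom].
Qed.

Lemma cts_dvel v i : {for U, continuous (fun y : state R n => dvel y v i 0)}.
Proof.
apply: (ctsE (g := fun y : state R n => (rho y)^-1 * (mom v i 0 - rho v * vel y i 0))) => [y|].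
  by rewrite /dvel !mxE.
apply: ctsM; first exact: cts_invrho.
by apply: ctsB; [exact: cts_cst|apply: ctsM; [exact: cts_cst|exact: cts_vel]].
Qed.

Lemma cts_vel2 : {for U, continuous (fun y : state R n => dotv (vel y) (vel y))}.
Proof. by apply: cts_dotv => i; exact: cts_vel. Qed.

Lemma cts_mag2 : {for U, continuous (fun y : state R n => dotv (mag y) (mag y))}.
Proof. by apply: cts_dotv => i; exact: cts_mag. Qed.

Lemma cts_velmag : {for U, continuous (fun y : state R n => dotv (vel y) (mag y))}.
Proof. by apply: cts_dotv => i; [exact: cts_vel|exact: cts_mag]. Qed.

Lemma cts_pressure : {for U, continuous (@pressure R n)}.
Proof.
apply: (ctsE pressureE).
apply: ctsM; first exact: cts_cst.
apply: ctsB; first apply: ctsB; first exact: cts_energy.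
  apply: ctsM; first exact: cts_cst.
  by apply: ctsM; [exact: cts_rho|exact: cts_vel2].
by apply: ctsM; [exact: cts_cst|exact: cts_mag2].
Qed.

Lemma cts_invpressure : {for U, continuous (fun y : state R n => (pressure y)^-1)}.
Proof. by apply: ctsV => //; exact: cts_pressure. Qed.

Lemma cts_source i : {for U, continuous (fun y : state R n => source y i 0)}.
Proof.
have ME (a : R) : (@scalar_mx R 1 a) 0 0 = a by rewrite mxE eqxx mulr1n.
case: (split_ordP i) => j ->.
  apply: (ctsE (g := fun=> 0)) => [y|]; last exact: cts_cst.
  by rewrite /source col_mxEu mxE.
case: (split_ordP j) => {}j ->.
  apply: (ctsE (g := fun y => mag y j 0)) => [y|]; last exact: cts_mag.
  by rewrite /source col_mxEd col_mxEu.
case: (split_ordP j) => {}j ->.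
  apply: (ctsE (g := fun y => dotv (vel y) (mag y))) => [y|]; last exact: cts_velmag.
  by rewrite /source !col_mxEd col_mxEu ord1 ME.
apply: (ctsE (g := fun y => vel y j 0)) => [y|]; last exact: cts_vel.
by rewrite /source !col_mxEd.
Qed.

Lemma cts_pstar : {for U, continuous (@pstar R n)}.
Proof.
apply: (ctsE (g := fun y => pressure y + 2^-1 * dotv (mag y) (mag y))) => [y|].
  by rewrite /pstar sqr_norm2.
apply: ctsD; first exact: cts_pressure.
by apply: ctsM; [exact: cts_cst|exact: cts_mag2].
Qed.

Lemma cts_dinternal v : {for U, continuous (fun y : state R n => dinternal y v)}.
Proof.
apply: ctsB; first apply: ctsB; first apply: ctsB.
- exact: cts_cst.
- apply: ctsM; first exact: cts_rho.
  by apply: cts_dotv => i; [exact: cts_vel|exact: cts_dvel].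
- by do 2! [apply: ctsM; first exact: cts_cst]; exact: cts_vel2.
- by apply: cts_dotv => i; [exact: cts_mag|exact: cts_cst].
Qed.

Lemma cts_dspec v : {for U, continuous (fun y : state R n => dspec y v)}.
Proof.
apply: ctsB.
  apply: ctsM; last exact: cts_invpressure.
  by apply: ctsM; [exact: cts_cst|exact: cts_dinternal].
apply: ctsM; first exact: cts_cst.
by apply: ctsM; [exact: cts_cst|exact: cts_invrho].
Qed.

Lemma cts_d2entropy v w : {for U, continuous (fun y : state R n => d2entropy y v w)}.
Proof.
apply: ctsD; first apply: ctsB.
- apply: ctsM; last exact: cts_cst.
  by apply: ctsN; apply: ctsM; [exact: cts_cst|exact: cts_dspec].
- apply: ctsM; last exact: cts_dinternal.
  apply: ctsB; first by apply: ctsM; [exact: cts_cst|exact: cts_invpressure].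
  apply: ctsM; last first.
    by apply: ctsV; [rewrite expf_neq0|apply: ctsX; exact: cts_pressure].
  apply: ctsM; first exact: cts_rho.
  by apply: ctsM; [exact: cts_cst|exact: cts_dinternal].
- apply: ctsM; first by apply: ctsM; [exact: cts_rho|exact: cts_invpressure].
  apply: ctsD; last exact: cts_cst.
  apply: ctsM; first exact: cts_rho.
  by apply: cts_dotv => i; exact: cts_dvel.
Qed.

Lemma cts_dpstar v : {for U, continuous (fun y : state R n => dpstar y v)}.
Proof.
apply: ctsD; first by apply: ctsM; [exact: cts_cst|exact: cts_dinternal].
by apply: cts_dotv => i; [exact: cts_mag|exact: cts_cst].
Qed.

Lemma cts_dflux v i : {for U, continuous (fun y : state R n => dflux y v i 0)}.
Proof.
have ME (a : R) : (@scalar_mx R 1 a) 0 0 = a by rewrite mxE eqxx mulr1n.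
have ZE k (a : R) (x : 'cV[R]_k) j : (a *: x) j 0 = a * x j 0 by rewrite mxE.
have DE k (x y : 'cV[R]_k) j : (x + y) j 0 = x j 0 + y j 0 by rewrite mxE.
have NE k (x : 'cV[R]_k) j : (- x) j 0 = - x j 0 by rewrite mxE.
have cu := cts_vel.
have cB k : {for U, continuous (fun y : state R n => mag y k 0)} by exact: cts_mag.
have cr : {for U, continuous (@rho R n)} by exact: cts_rho.
have cd k : {for U, continuous (fun y : state R n => dvel y v k 0)} by exact: cts_dvel.
have cp : {for U, continuous (@pstar R n)} by exact: cts_pstar.
have cdp : {for U, continuous (fun y : state R n => dpstar y v)} by exact: cts_dpstar.
have cm : {for U, continuous (fun y : state R n => rho v * ux y + rho y * dvel y v 0 0)}.
  apply: ctsD; last by apply: ctsM; [exact: cr|exact: cd].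
  by apply: ctsM; [exact: cts_cst|exact: cu].
case: (split_ordP i) => j ->.
  apply: ctsE cm => y; by rewrite /dflux col_mxEu ord1 ME.
case: (split_ordP j) => {}j ->.
  apply: (ctsE (g := fun y => (rho v * ux y + rho y * dvel y v 0 0) * vel y j 0
    + (rho y * ux y) * dvel y v j 0 + dpstar y v * (delta_mx 0 0 : 'cV[R]_n.+1) j 0
    - (Bx v * mag y j 0 + Bx y * mag v j 0))) => [y|].
    rewrite /dflux col_mxEd col_mxEu.
    by move: (delta_mx _ _) (vel y) (dvel y v) (mag y) (mag v) => ? ? ? ? ?; rewrite !(DE, NE, ZE).
  apply: ctsB; first apply: ctsD; first apply: ctsD.
  - by apply: ctsM; [exact: cm|exact: cu].
  - by apply: ctsM; [apply: ctsM; [exact: cr|exact: cu]|exact: cd].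
  - by apply: ctsM; [exact: cdp|exact: cts_cst].
  - apply: ctsD; first by apply: ctsM; [exact: cts_cst|exact: cB].
    by apply: ctsM; [exact: cB|exact: cts_cst].
case: (split_ordP j) => {}j ->.
  apply: (ctsE (g := fun y => dvel y v 0 0 * (energy y + pstar y)
          + ux y * (energy v + dpstar y v)
          - (Bx v * dotv (vel y) (mag y)
             + Bx y * (dotv (dvel y v) (mag y) + dotv (vel y) (mag v))))) => [y|].
    by rewrite /dflux !col_mxEd col_mxEu ord1 ME.
  apply: ctsB; first apply: ctsD.
  - by apply: ctsM; [exact: cd|apply: ctsD; [exact: cts_energy|exact: cp]].
  - by apply: ctsM; [exact: cu|apply: ctsD; [exact: cts_cst|exact: cdp]].
  - apply: ctsD; first by apply: ctsM; [exact: cts_cst|exact: cts_velmag].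
    apply: ctsM; first exact: cB.
    apply: ctsD; first by apply: cts_dotv => k; [exact: cd|exact: cB].
    by apply: cts_dotv => k; [exact: cu|exact: cts_cst].
apply: (ctsE (g := fun y => dvel y v 0 0 * mag y j 0 + ux y * mag v j 0
    - (Bx v * vel y j 0 + Bx y * dvel y v j 0))) => [y|].
  rewrite /dflux !col_mxEd.
  by move: (ux y) (vel y) (dvel y v) (mag y) (mag v) => ? ? ? ? ?; rewrite !(DE, NE, ZE).
apply: ctsB; first apply: ctsD.
- by apply: ctsM; [exact: cd|exact: cB].
- by apply: ctsM; [exact: cu|exact: cts_cst].
- apply: ctsD; first by apply: ctsM; [exact: cts_cst|exact: cu].
  by apply: ctsM; [exact: cB|exact: cd].
Qed.

End AtState.
End MHDContinuity.

Section MHDLines.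
Context {R : realType} {n : nat}.
Implicit Types (U v w d : state R n) (t : R).

Lemma G_line_near U v t : G (U + t *: v) -> \forall s \near t, G (U + s *: v).
Proof.
move=> [rp pp]; have r1 : rho (U + t *: v) != 0 by rewrite gt_eqF.
have cr := isd_continuous (isd_rho U v t).
have cp := isd_continuous (isd_pressure r1).
near=> s; split; near: s.
  exact: (cvgr_gt _ cr).
exact: (cvgr_gt _ cp).
Unshelve. all: by end_near. Qed.

Lemma mom_vel U : rho U != 0 -> mom U = rho U *: vel U.
Proof. by move=> r0; rewrite /vel scalerA divff// scale1r. Qed.

Lemma G_convex U V t : G U -> G V -> t \in `[0, 1] -> G (U + t *: (V - U)).
Proof.
move=> [rU pU] [rV pV]; rewrite in_itv /= => /andP[t0 t1].
pose W := U + t *: (V - U).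
have gp := @gamB1_gt0 R.
have t1' : 0 <= 1 - t by rewrite subr_ge0.
have WE : W = (1 - t) *: U + t *: V.
  by rewrite /W scalerBr scalerBl scale1r addrCA addrC -!addrA addrC.
have comb (a b : R) : 0 < a -> 0 < b -> 0 < (1 - t) * a + t * b.
  move=> a0 b0; have [t_0|t_0] := eqVneq t 0.
    by rewrite t_0 subr0 mul1r mul0r addr0.
  apply: ltr_wpDl; first by apply: mulr_ge0 => //; exact: ltW.
  by apply: mulr_gt0 => //; rewrite lt_neqAle eq_sym t_0.
have [rW EW mW BW] : [/\ rho W = (1 - t) * rho U + t * rho V,
    energy W = (1 - t) * energy U + t * energy V,
    mom W = (1 - t) *: mom U + t *: mom V &
    mag W = (1 - t) *: mag U + t *: mag V].
  have tV (x : state R n) : t *: x = t *: x + 0 by rewrite addr0.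
  have rho0 : rho (0 : state R n) = 0 by rewrite /rho !mxE.
  have energy0 : energy (0 : state R n) = 0 by rewrite /energy !mxE.
  have mom0 : mom (0 : state R n) = 0 by apply/matrixP => i j; rewrite /mom !mxE.
  have mag0 : mag (0 : state R n) = 0 by apply/matrixP => i j; rewrite /mag !mxE.
  rewrite WE tV; split.
  - by rewrite !rho_linear rho0 addr0.
  - by rewrite !energy_linear energy0 addr0.
  - by rewrite !mom_linear mom0 addr0.
  - by rewrite !mag_linear mag0 addr0.
have rWp : 0 < rho W by rewrite rW comb.
split=> //; rewrite -/W.
have [rU0 rV0 rW0] : [/\ rho U != 0, rho V != 0 & rho W != 0].
  by split; rewrite lt0r_neq0.
(* The last summand is the convexity defect of the kinetic and magnetic energies. *)
have -> : pressure W = (1 - t) * pressure U + t * pressure V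
    + (gam - 1) * 2^-1 * ((1 - t) * t) *
     (rho U * rho V / rho W * dotv (vel U - vel V) (vel U - vel V)
      + dotv (mag U - mag V) (mag U - mag V)).
  rewrite !pressureE EW BW.
  have -> : vel W = (rho W)^-1 *: ((1 - t) *: (rho U *: vel U) + t *: (rho V *: vel V)).
    by rewrite {1}/vel mW !mom_vel.
  move: (vel U) (vel V) (mag U) (mag V) => x y z w.
  rewrite !dotvP (dotvC y x) (dotvC w z).
  by rewrite rW in rW0 *; field.
apply: ltr_pwDl; first exact: comb.
apply: mulr_ge0.
  by apply: mulr_ge0; apply: mulr_ge0 => //; exact: ltW.
apply: addr_ge0; last exact: dotv_ge0.
apply: mulr_ge0; last exact: dotv_ge0.
by apply: divr_ge0; [apply: mulr_ge0|]; exact: ltW.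
Qed.

Lemma derive_line (f : state R n -> R) U v (df : R) :
  is_derive (0 : R) 1 (fun t => f (U + t *: v)) df -> 'D_v f U = df.
Proof.
move=> [_ <-]; rewrite /derive.
have -> // : (fun h : R => h^-1 *: ((f \o shift U) (h *: v) - f U)) =
  (fun h => h^-1 *: (((fun t => f (U + t *: v)) \o shift 0) (h *: 1) - f (U + 0 *: v))).
apply/funext => h /=; rewrite scale0r addr0 addr0 [h *: v + U]addrC.
by rewrite [h *: 1]mulr1.
Qed.

Lemma grad_entropyE U j : G U -> grad entropy U 0 j = dentropy U (delta_mx j 0).
Proof.
move=> GU; rewrite mxE; apply: derive_line.
have GU0 : G (U + 0 *: delta_mx j 0) by rewrite scale0r addr0.
by have := isd_entropy GU0; rewrite scale0r addr0.
Qed.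

Lemma grad_entropy_mul U v : G U -> (grad entropy U *m v) 0 0 = dentropy U v.
Proof.
move=> GU; rewrite mxE [RHS](linear_deltaE (f := dentropy U) v (dentropy_linear U)).
by apply: eq_bigr => j _; rewrite grad_entropyE// mulrC.
Qed.

Lemma hess_entropyE U i j : G U ->
  hess entropy U i j = d2entropy U (delta_mx i 0) (delta_mx j 0).
Proof.
move=> GU; rewrite mxE; apply: derive_line.
have GU0 : G (U + 0 *: delta_mx j 0) by rewrite scale0r addr0.
have := isd_dentropy (delta_mx i 0) GU0; rewrite scale0r addr0 => H.
apply: near_eq_is_derive H.
by near=> s; rewrite mxE grad_entropyE//; near: s; exact: G_line_near.
Unshelve. all: by end_near. Qed.

Lemma hess_entropy_sym U : G U -> (hess entropy U)^T = hess entropy U.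
Proof.
by move=> GU; apply/matrixP => i j; rewrite [LHS]mxE !hess_entropyE// d2entropyC.
Qed.

Lemma hess_entropy_form U v w : G U ->
  (v^T *m hess entropy U *m w) 0 0 = d2entropy U v w.
Proof.
move=> GU; rewrite mxE.
rewrite (linear_deltaE (f := fun v => d2entropy U v w) v); last first.
  by move=> a y z; rewrite d2entropy_linear.
under eq_bigr do rewrite mxE mulr_suml.
rewrite exchange_big /=; apply: eq_bigr => i _.
rewrite d2entropyC// (linear_deltaE (f := fun w => d2entropy U w (delta_mx i 0)) w); last first.
  by move=> a y z; rewrite d2entropy_linear.
rewrite mulr_sumr; apply: eq_bigr => j _.
by rewrite hess_entropyE// d2entropyC// [v^T _ _]mxE; ring.
Qed.

Lemma dpstar_linear U a v w : dpstar U (a *: v + w) = a * dpstar U v + dpstar U w.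
Proof. by rewrite /dpstar dinternal_linear mag_linear !dotvP; ring. Qed.

Lemma Bx_linear a v w : Bx (a *: v + w) = a * Bx v + Bx w.
Proof. by rewrite /Bx mag_linear !mxE. Qed.

Lemma dflux_linear U a v w : dflux U (a *: v + w) = a *: dflux U v + dflux U w.
Proof.
have E : dvel U (a *: v + w) 0 0 = a * dvel U v 0 0 + dvel U w 0 0.
  by rewrite dvel_linear; move: (dvel U v) (dvel U w) => x y; rewrite !mxE.
rewrite /dflux E rho_linear dvel_linear dpstar_linear Bx_linear energy_linear mag_linear.
move: (dvel U v 0 0) (dvel U w 0 0) (dvel U v) (dvel U w) (vel U)
  (mag U) (mag v) (mag w) (ux U) (Bx U)
  (Bx v) (Bx w) => x y x' y' z b b' b'' u c c' c''.
rewrite !scale_col_mx !add_col_mx; congr col_mx; last congr col_mx; last congr col_mx.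
- by rewrite scale_scalar_mx -raddfD; congr (_%:M); ring.
- by apply/matrixP => i j; rewrite !mxE; ring.
- by rewrite scale_scalar_mx -raddfD /= !dotvP; congr (_%:M); ring.
- by apply/matrixP => i j; rewrite !mxE; ring.
Qed.

Lemma jac_flux_mul U v : G U -> jac flux U *m v = dflux U v.
Proof.
move=> GU; apply/matrixP => i k; rewrite (ord1 k) mxE.
rewrite (linear_deltaE (f := fun v => dflux U v i 0) v); last first.
  move=> a y z; rewrite dflux_linear.
  by move: (dflux U y) (dflux U z) => ? ?; rewrite !mxE.
apply: eq_bigr => j _; rewrite [LHS]mulrC; congr (_ * _).
rewrite mxE; apply: derive_line.
have r0 : rho (U + 0 *: delta_mx j 0) != 0.
  by rewrite scale0r addr0 lt0r_neq0//; case: GU.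
by have := isd_flux i r0; rewrite scale0r addr0.
Qed.

Lemma dBx_mul v : dBx *m v = (Bx v)%:M.
Proof.
have -> : v = col_mx (usubmx v) (col_mx (mom v) (col_mx (usubmx (dsubmx (dsubmx v))) (mag v))).
  by rewrite !vsubmxK.
rewrite /dBx !mul_row_col !mul0mx !add0r; apply/matrixP => i j; rewrite !ord1.
rewrite -rowE [LHS]mxE [RHS]mxE eqxx mulr1n /Bx /mag !col_mxKd.
by [].
Qed.

Lemma dentropy_source U : G U ->
  dentropy U (source U) = rho U / pressure U * dotv (vel U) (mag U).
Proof.
move=> [/lt0r_neq0 r0 /lt0r_neq0 p0].
have rs : rho (source U) = 0 by rewrite /rho /source col_mxKu mxE.
have ms : mom (source U) = mag U by rewrite /mom /source col_mxKd col_mxKu.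
have es : energy (source U) = dotv (vel U) (mag U).
  by rewrite /energy /source !col_mxKd col_mxKu mxE eqxx mulr1n.
have Bs : mag (source U) = vel U by rewrite /mag /source !col_mxKd.
rewrite /dentropy /dinternal /dvel rs ms es Bs scale0r subr0.
move: (vel U) (mag U) => x y; rewrite !dotvP (dotvC y x).
by field; rewrite p0 r0 gamB1_neq0.
Qed.

End MHDLines.

Section Segments.
Context {R : realType} {n : nat}.
Implicit Types (U v w d : state R n) (t : R).

Lemma cts_line (f : state R n -> R) U d t : {for U + t *: d, continuous f} ->
  {for t, continuous (fun s : R => f (U + s *: d))}.
Proof.
move=> cf; apply: (@continuous_comp _ _ _ (fun s : R => U + s *: d) f t) cf.
by apply: cvgD; [exact: cvg_cst|apply: cvgZl; exact: cvg_id].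
Qed.

Lemma MVT_line (f df : R -> R) t : 0 < t ->
  (forall s : R, s \in `[0, t] -> is_derive s 1 f (df s)) ->
  exists2 c, c \in `]0, t[ & f t - f 0 = df c * t.
Proof.
move=> t0 dfP.
have A (s : R) : s \in `]0, t[ -> is_derive s 1 f (df s).
  by move=> /subset_itv_oo_cc s0t; exact: dfP.
have B : {within `[0, t], continuous f}.
  apply: continuous_in_subspaceT => s /set_mem s0t; have ds := dfP s s0t.
  exact: isd_continuous ds.
by have [c ct fE] := MVT t0 A B; exists c => //; rewrite fE subr0.
Qed.

Section OneSegment.
Variables (U d : state R n).
Hypothesis GU : forall t, t \in `[0, 1] -> G (U + t *: d).


Lemma entropy_MVT : exists s t, [/\ s \in `[0, 1], 0 < t &
  entropy (U + d) - entropy U - dentropy U d = t * d2entropy (U + s *: d) d d].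
Proof.
have [c c01] := MVT_line ltr01 (fun s s01 => isd_entropy (GU s01)).
rewrite scale1r scale0r addr0 mulr1 => H1.
have cp : 0 < c by move: c01; rewrite in_itv /= => /andP[].
have sub s : s \in `[0, c] -> s \in `[0, 1].
  move: c01; rewrite !in_itv /= => /andP[_ /ltW cle] /andP[-> sc].
  by rewrite (le_trans sc).
have [s sc] := MVT_line cp (fun s sc => isd_dentropy d (GU (sub _ sc))).
rewrite scale0r addr0 => H2.
exists s, c; split => //; first by apply: sub; exact: subset_itv_oo_cc.
by rewrite H1 H2 mulrC.
Qed.

Lemma entropy_gap_gt0 : d != 0 -> 0 < entropy (U + d) - entropy U - dentropy U d.
Proof.
move=> d0; have [s [t [s01 t0 ->]]] := entropy_MVT.
by rewrite mulr_gt0// d2entropy_gt0//; exact: GU.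
Qed.

Lemma entropy_formE :
  entropy_form U d = entropy (U + d) - entropy U - dentropy U d.
Proof.
rewrite /entropy_form.
transitivity (Lint 0 1 (fun s => dentropy (U + s *: d) d - dentropy U d)).
  apply: eq_Lint => s s01.
  have sub t : t \in `[0, s] -> t \in `[0, 1].
    by move: s01; rewrite !in_itv /= => /andP[_ s1] /andP[-> /le_trans ->].
  transitivity (Lint 0 s (fun t => d2entropy (U + t *: d) d d)).
    by apply: eq_Lint => t /sub t01; rewrite hess_entropy_form//; exact: GU.
  rewrite -[X in _ - dentropy X d](_ : U + 0 *: d = U); last by rewrite scale0r addr0.
  apply: (@Lint_FTC _ 0 s _ (fun t => dentropy (U + t *: d) d)).
  - by move: s01; rewrite in_itv /= => /andP[].
  - move=> t /sub /GU Gt; apply: (cts_line (f := fun y => d2entropy y d d)).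
    exact: cts_d2entropy.
  - by move=> t /sub /GU Gt; exact: isd_dentropy.
transitivity ((entropy (U + 1 *: d) - 1 * dentropy U d) -
    (entropy (U + 0 *: d) - 0 * dentropy U d)); last first.
  by rewrite scale0r addr0 scale1r mul1r mul0r subr0 addrAC.
apply: (@Lint_FTC _ 0 1 _ (fun t => entropy (U + t *: d) - t * dentropy U d)).
- exact: ler01.
- move=> t /GU Gt; apply: ctsB; last exact: cts_cst.
  exact: isd_continuous (isd_dentropy d Gt).
- move=> t /GU Gt; apply: isdB; first exact: isd_entropy.
  by apply: is_derive_eq (isdMr _ (is_derive_id t 1)) _; rewrite mul1r.
Qed.

Definition source_term (y v : state R n) : R := rho y / pressure y * dotv (vel y) (mag y) * Bx v.

Lemma source_termE y v : G y ->
  (grad entropy y *m source y *m dBx *m v) 0 0 = source_term y v.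
Proof.
move=> Gy; rewrite -mulmxA dBx_mul mul_mx_scalar mxE grad_entropy_mul//.
by rewrite dentropy_source// mulrC.
Qed.

Lemma cts_source_term t : t \in `[0, 1] ->
  {for t, continuous (fun s : R => source_term (U + s *: d) d)}.
Proof.
move=> /GU Gt; apply: (cts_line (f := fun y => source_term y d)).
apply: ctsM; last exact: cts_cst.
by apply: ctsM; [apply: ctsM; [exact: cts_rho|exact: cts_invpressure]|exact: cts_velmag].
Qed.

Lemma flux_formE :
  flux_form U d + Lint 0 1 (fun s => source_term (U + s *: d) d) =
  entropy_flux (U + d) - entropy_flux U - dentropy U (flux (U + d) - flux U).
Proof.
have dL x : dentropy U x = \sum_i x i 0 * dentropy U (delta_mx i 0).
  exact: (linear_deltaE (f := dentropy U) x (dentropy_linear U)).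
pose f1 (s : R) : R := dentropy_flux (U + s *: d) d.
pose f2 (s : R) : R := dentropy U (dflux (U + s *: d) d).
have cf1 s : s \in `[0, 1] -> {for s, continuous f1}.
  move=> /GU Gs; apply: ctsD; apply: ctsM.
  - exact: isd_continuous (isd_dentropy d Gs).
  - by apply: (cts_line (f := fun y => vel y 0 0)); exact: cts_vel.
  - exact: isd_continuous (isd_entropy Gs).
  - by apply: (cts_line (f := fun y => dvel y d 0 0)); exact: cts_dvel.
have cf2 s : s \in `[0, 1] -> {for s, continuous f2}.
  move=> /GU Gs; apply: (ctsE (fun s => dL _)).
  apply: cvg_sum => i.
  suff : {for s, continuous (fun s : R => dflux (U + s *: d) d i 0 *
    dentropy U (delta_mx i 0))} by [].
  apply: ctsM; last exact: cts_cst.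
  by apply: (cts_line (f := fun y => dflux y d i 0)); exact: cts_dflux.
have -> : flux_form U d =
    Lint 0 1 (fun s => f1 s - source_term (U + s *: d) d - f2 s).
  apply: eq_Lint => s s01; have Gs := GU s01.
  have sub t : t \in `[0, s] -> t \in `[0, 1].
    by move: s01; rewrite !in_itv /= => /andP[_ s1] /andP[-> /le_trans ->].
  transitivity (Lint 0 s (fun t => d2entropy (U + t *: d) (dflux (U + s *: d) d) d)).
    apply: eq_Lint => t /sub /GU Gt.
    by rewrite -mulmxA jac_flux_mul// hess_entropy_form// d2entropyC.
  transitivity (dentropy (U + s *: d) (dflux (U + s *: d) d)
      - dentropy (U + 0 *: d) (dflux (U + s *: d) d)); last first.
    by rewrite scale0r addr0 /f1 entropy_compatible// /source_term addrK.
  apply: (@Lint_FTC _ 0 s _ (fun t => dentropy (U + t *: d) (dflux (U + s *: d) d))).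
  - by move: s01; rewrite in_itv /= => /andP[].
  - move=> t /sub /GU Gt.
    apply: (cts_line (f := fun y => d2entropy y (dflux (U + s *: d) d) d)).
    exact: cts_d2entropy.
  - by move=> t /sub /GU Gt; exact: isd_dentropy.
have i1 := continuous_itv_integrable cf1.
have i2 := continuous_itv_integrable cf2.
have i3 := continuous_itv_integrable cts_source_term.
have i13 : itv_integrable 0 1 (fun s => f1 s - source_term (U + s *: d) d).
  by apply: continuous_itv_integrable => s s01; apply: ctsB; [exact: cf1|exact: cts_source_term].
rewrite LintB// LintB//.
have -> : Lint 0 1 f1 = entropy_flux (U + 1 *: d) - entropy_flux (U + 0 *: d).
  apply: (@Lint_FTC _ 0 1 f1 (fun s => entropy_flux (U + s *: d))) => //.
  by move=> t /GU Gt; exact: isd_entropy_flux.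
have -> : Lint 0 1 f2 = dentropy U (flux (U + 1 *: d)) - dentropy U (flux (U + 0 *: d)).
  apply: (@Lint_FTC _ 0 1 f2 (fun s => dentropy U (flux (U + s *: d))));
    [exact: ler01|exact: cf2|].
  move=> t /GU [/lt0r_neq0 r0 _]; rewrite /f2 dL.
  rewrite (_ : (fun s => _) = fun s =>
    \sum_i flux (U + s *: d) i 0 * dentropy U (delta_mx i 0)); last first.
    by apply/funext => s; rewrite dL.
  by apply: isd_sum => i; apply: isdMr; exact: isd_flux.
rewrite !scale0r !scale1r addr0.
have -> : dentropy U (flux (U + d) - flux U) = dentropy U (flux (U + d)) - dentropy U (flux U).
  by rewrite addrC -scaleN1r dentropy_linear mulN1r addrC.
by rewrite addrAC subrK.
Qed.

End OneSegment.

Lemma entropy_le_quadratic U d (K : R) :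
  (forall t, t \in `[0, 1] -> G (U + t *: d)) ->
  (forall t, t \in `[0, 1] -> d2entropy (U + t *: d) d d <= K) ->
  entropy (U + d) <= entropy U + dentropy U d + K / 2.
Proof.
move=> GU dK.
have [|c c01] := @MVT_line (fun t => entropy (U + t *: d) - t ^+ 2 * (K / 2))
  (fun t => dentropy (U + t *: d) d - t * K) 1 ltr01.
  move=> s /GU Gs; apply: isdB; first exact: isd_entropy.
  apply: is_derive_eq (isdMr _ (isdM (is_derive_id s 1) (is_derive_id s 1))) _.
  by rewrite mul1r mulr1; field.
rewrite scale1r scale0r addr0 => H1.
have cp : 0 < c by move: c01; rewrite in_itv /= => /andP[].
have sub s : s \in `[0, c] -> s \in `[0, 1].
  move: c01; rewrite !in_itv /= => /andP[_ /ltW cle] /andP[-> sc].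
  by rewrite (le_trans sc).
have [s sc] := MVT_line cp (fun s sc => isd_dentropy d (GU _ (sub _ sc))).
rewrite scale0r addr0 => H2.
have := dK s (sub _ (subset_itv_oo_cc sc)).
rewrite -(ler_pM2r cp) -H2; lra.
Qed.

End Segments.

Section Scheme.
Context {R : realType} {n : nat}.
Implicit Types (U v w d : state R n) (t : R) (Phi : R -> state R n).

Lemma dentropyD U v w : dentropy U (v + w) = dentropy U v + dentropy U w.
Proof. by rewrite -[v]scale1r dentropy_linear mul1r scale1r. Qed.

Lemma dentropy0 U : dentropy U 0 = 0.
Proof. by apply: (addrI (dentropy U 0)); rewrite -dentropyD !addr0. Qed.

Lemma dentropyZ U (a : R) v : dentropy U (a *: v) = a * dentropy U v.
Proof. by rewrite -[a *: v]addr0 dentropy_linear dentropy0 addr0. Qed.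

Lemma dentropyN U v : dentropy U (- v) = - dentropy U v.
Proof. by rewrite -scaleN1r dentropyZ mulN1r. Qed.

Lemma Bx_entry v : Bx v = v (rshift 1 (rshift n.+1 (rshift 1 0))) 0.
Proof. by rewrite /Bx /mag !mxE. Qed.

Lemma mul_source_dBx (y v : state R n) i : (source y *m (dBx *m v)) i 0 = source y i 0 * Bx v.
Proof. by rewrite dBx_mul mul_mx_scalar mxE mulrC. Qed.

Section OnePath.
Variables (U a b : state R n) (Phi : R -> state R n).
Hypotheses (GU : G U) (PhiP : gen_path Phi a b).

Definition path_term (s : R) : R :=
  (grad entropy U *m source (Phi s) *m dBx *m derive1 Phi s) 0 0.

Lemma integrable_path_entry i : itv_integrable 0 1
  (fun s => (source (Phi s) *m (dBx *m derive1 Phi s)) i 0).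
Proof.
have [_ _ GPhi [K PhiK]] := PhiP.
rewrite /itv_integrable (_ : (fun s => _) =
  fun s => source (Phi s) i 0 * derive1 Phi s (rshift 1 (rshift n.+1 (rshift 1 0))) 0).
  apply: (integrable_path_derive1 (s := fun y : state R n => source y i 0)) => // x x01.
    exact: PhiK.
  by apply: cts_source; exact: GPhi.
by apply/funext => s; rewrite mul_source_dBx Bx_entry.
Qed.

Lemma path_termE s : path_term s =
  \sum_i grad entropy U 0 i * (source (Phi s) *m (dBx *m derive1 Phi s)) i 0.
Proof. by rewrite /path_term -!mulmxA mxE. Qed.

Lemma integrable_path_term : itv_integrable 0 1 path_term.
Proof.
rewrite (_ : path_term = fun s => \sum_i grad entropy U 0 i *
   (source (Phi s) *m (dBx *m derive1 Phi s)) i 0); last first.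
  by apply/funext => s; exact: path_termE.
apply: itv_integrable_sum => i; apply: itv_integrableZl; exact: integrable_path_entry.
Qed.

Lemma Lint_path_term : Lint 0 1 path_term = dentropy U (path_int Phi).
Proof.
rewrite -grad_entropy_mul// mxE.
transitivity (Lint 0 1 (fun s => \sum_i grad entropy U 0 i *
   (source (Phi s) *m (dBx *m derive1 Phi s)) i 0)).
  by apply: eq_Lint => s _; exact: path_termE.
rewrite Lint_sum => [|i]; last by apply: itv_integrableZl; exact: integrable_path_entry.
apply: eq_bigr => i _; rewrite LintZl; last exact: integrable_path_entry.
by congr (_ * _); rewrite [RHS]mxE.
Qed.

Section OneSide.
Variable d : state R n.
Hypothesis Gd : forall t, t \in `[0, 1] -> G (U + t *: d).

Let i1 : itv_integrable 0 1 (fun s => source_term (U + s *: d) d).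
Proof. by apply: continuous_itv_integrable => s s01; exact: cts_source_term. Qed.

Lemma deltaA_plusE : deltaA_plus U d Phi =
  Lint 0 1 (fun s => source_term (U + s *: d) d) - dentropy U (path_int Phi).
Proof.
rewrite -Lint_path_term -LintB//; last exact: integrable_path_term.
by apply: eq_Lint => s /Gd Gs; rewrite source_termE.
Qed.

Lemma deltaA_minusE : deltaA_minus U d Phi =
  Lint 0 1 (fun s => source_term (U + s *: d) d) + dentropy U (path_int Phi).
Proof.
rewrite -Lint_path_term -LintD//; last exact: integrable_path_term.
by apply: eq_Lint => s /Gd Gs; rewrite source_termE.
Qed.

End OneSide.
End OnePath.

Section WaveSpeeds.
Variables (SR SL : state R n -> state R n -> R).
Hypothesis hS : wave_speeds SR SL.

Lemma speed_gap_neq0 a b : G a -> G b -> SR a b - SL a b != 0.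
Proof. by move=> Ga Gb; have [_ _ lt] := hS Ga Gb; rewrite subr_eq0 gt_eqF. Qed.

Lemma hll_flux_diag U : G U -> hll_flux SR SL U U = flux U.
Proof.
move=> GU; have D := speed_gap_neq0 GU GU.
by rewrite /hll_flux subrr scaler0 addr0 -scalerBl scalerA mulVf// scale1r.
Qed.

Lemma hll_entropy_flux_diag U : G U -> hll_entropy_flux SR SL U U = entropy_flux U.
Proof.
move=> GU; have D := speed_gap_neq0 GU GU.
by rewrite /hll_entropy_flux subrr mulr0 addr0 -mulrBl mulrAC divff// mul1r.
Qed.

Lemma T1_formula U Up Phi : G U -> G Up -> gen_path Phi U Up ->
  T1 SR SL U Up Phi = Rminus SR SL U Up *
    (flux_form U (Up - U) + deltaA_plus U (Up - U) Phi
     - SR U Up * entropy_form U (Up - U)).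
Proof.
move=> GU GUp PhiP; have D := speed_gap_neq0 GU GUp.
have Gd t : t \in `[0, 1] -> G (U + t *: (Up - U)) by exact: G_convex.
rewrite (deltaA_plusE GU PhiP Gd) addrA (flux_formE Gd) (entropy_formE Gd).
have -> : U + (Up - U) = Up by rewrite addrC subrK.
rewrite /T1 grad_entropy_mul// hll_flux_diag// hll_entropy_flux_diag//.
rewrite /Aminus /hll_flux /hll_entropy_flux /Rminus.
move: (path_int Phi) (flux U) (flux Up) => p f g.
rewrite !(dentropyD, dentropyN, dentropyZ).
move: (entropy Up) (entropy U) (entropy_flux Up) (entropy_flux U) => e e' q q'.
by field.
Qed.

Lemma T2_formula Um U Phi : G Um -> G U -> gen_path Phi Um U ->
  T2 SR SL Um U Phi = Rplus SR SL Um U *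
    (flux_form U (Um - U) + deltaA_minus U (Um - U) Phi
     - SL Um U * entropy_form U (Um - U)).
Proof.
move=> GUm GU PhiP; have D := speed_gap_neq0 GUm GU.
have Gd t : t \in `[0, 1] -> G (U + t *: (Um - U)) by exact: G_convex.
rewrite (deltaA_minusE GU PhiP Gd) addrA (flux_formE Gd) (entropy_formE Gd).
have -> : U + (Um - U) = Um by rewrite addrC subrK.
rewrite /T2 grad_entropy_mul// hll_flux_diag// hll_entropy_flux_diag//.
rewrite /Aplus /hll_flux /hll_entropy_flux /Rplus.
move: (path_int Phi) (flux U) (flux Um) => p f g.
rewrite !(dentropyD, dentropyN, dentropyZ).
move: (entropy Um) (entropy U) (entropy_flux Um) (entropy_flux U) => e e' q q'.
by field.
Qed.

Lemma T1_le0 U Up Phi : G U -> G Up -> U != Up -> gen_path Phi U Up ->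
  SR U Up >= (flux_form U (Up - U) + deltaA_plus U (Up - U) Phi)
             / entropy_form U (Up - U) ->
  T1 SR SL U Up Phi <= 0.
Proof.
move=> GU GUp UUp PhiP; have [_ SL0 SLR] := hS GU GUp.
have Gd t : t \in `[0, 1] -> G (U + t *: (Up - U)) by exact: G_convex.
have e0 : 0 < entropy_form U (Up - U).
  by rewrite (entropy_formE Gd) (entropy_gap_gt0 Gd)// subr_eq0 eq_sym.
rewrite ler_pdivrMr// => H; rewrite T1_formula//.
rewrite mulr_ge0_le0 ?subr_le0// divr_ge0 ?oppr_ge0// subr_ge0 ltW//.
Qed.

Lemma T2_ge0 Um U Phi : G Um -> G U -> U != Um -> gen_path Phi Um U ->
  SL Um U <= (flux_form U (Um - U) + deltaA_minus U (Um - U) Phi)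
             / entropy_form U (Um - U) ->
  0 <= T2 SR SL Um U Phi.
Proof.
move=> GUm GU UUm PhiP; have [SR0 _ SLR] := hS GUm GU.
have Gd t : t \in `[0, 1] -> G (U + t *: (Um - U)) by exact: G_convex.
have e0 : 0 < entropy_form U (Um - U).
  by rewrite (entropy_formE Gd) (entropy_gap_gt0 Gd)// subr_eq0 eq_sym.
rewrite ler_pdivlMr// => H; rewrite T2_formula//.
rewrite mulr_ge0 ?subr_ge0// divr_ge0// subr_ge0 ltW//.
Qed.

Lemma T1_T2_T3 Um U Up Phim Phip : G U ->
  T1 SR SL U Up Phip - T2 SR SL Um U Phim =
  hll_entropy_flux SR SL U Up - hll_entropy_flux SR SL Um U
  - dentropy U (T3 SR SL Um U Up Phim Phip).
Proof.
move=> GU; rewrite /T1 /T2 /T3 !grad_entropy_mul//.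
move: (hll_flux _ _ _ _) (hll_flux _ _ U U) (hll_flux _ _ Um U) => a b c.
move: (Aminus _ _ _ _ _) (Aplus _ _ _ _ _) => p q.
move: (hll_entropy_flux _ _ _ _) (hll_entropy_flux _ _ U U) (hll_entropy_flux _ _ Um U) => a' b' c'.
rewrite !(dentropyD, dentropyN).
move: (dentropy U a) (dentropy U b) (dentropy U c) (dentropy U p) (dentropy U q) => x y z w r.
ring.
Qed.

End WaveSpeeds.

Lemma segment_entropy_le U V (S := [set sigma_max (hess entropy eta) | eta in segm U V]) :
  G U -> G V -> has_ubound S ->
  entropy V <= entropy U + dentropy U (V - U) + sup S * dotv (V - U) (V - U) / 2.
Proof.
move=> GU GV ubS.
have Gd t : t \in `[0, 1] -> G (U + t *: (V - U)) by exact: G_convex.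
rewrite -[in leLHS](subrK U V) addrC; apply: entropy_le_quadratic => // t t01.
have Gt := Gd t t01.
rewrite -hess_entropy_form//; apply: le_trans (sigma_max_rayleigh _ (hess_entropy_sym Gt)) _.
apply: ler_wpM2r; first exact: dotv_ge0.
apply: ub_le_sup => //; exists (U + t *: (V - U)) => //.
exists (1 - t).
  by move: t01; rewrite /= !in_itv /= => /andP[t0 t1]; rewrite subr_ge0 t1 gerBl.
by rewrite subKr scalerBl scale1r scalerBr addrAC addrA.
Qed.

End Scheme.

Theorem theorem3p3 (R : realType) (n : nat) (n_lt3 : (n < 3)%N)
    (SR SL : state R n -> state R n -> R) (hS : wave_speeds SR SL)
    (lambda : R) (Um U Up Unew : state R n) (Phim Phip : R -> state R n)
    (GUm : G Um) (GU : G U) (GUp : G Up) (GUnew : G Unew)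
    (UUm : U != Um) (UUp : U != Up)
    (hPhim : gen_path Phim Um U) (hPhip : gen_path Phip U Up)
    (scheme : Unew = U - lambda *: (hll_flux SR SL U Up - hll_flux SR SL Um U)
                       - lambda *: (Aminus SR SL U Up Phip
                                    + Aplus SR SL Um U Phim))
    (hSR : SR U Up >= (flux_form U (Up - U) + deltaA_plus U (Up - U) Phip)
                      / entropy_form U (Up - U))
    (hSL : SL Um U <= (flux_form U (Um - U) + deltaA_minus U (Um - U) Phim)
                      / entropy_form U (Um - U))
    (lambda_ge0 : 0 <= lambda)
    (CFL : T3 SR SL Um U Up Phim Phip != 0 ->
       lambda <= 2 * (T2 SR SL Um U Phim - T1 SR SL U Up Phip)
                 / norm2 (T3 SR SL Um U Up Phim Phip) ^+ 2
                 * (sup [set sigma_max (hess entropy eta)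
                        | eta in segm U Unew])^-1) :
  entropy Unew <= entropy U
    - lambda * (hll_entropy_flux SR SL U Up - hll_entropy_flux SR SL Um U).
Proof.
have T1le := T1_le0 hS GU GUp UUp hPhip hSR.
have T2ge := T2_ge0 hS GUm GU UUm hPhim hSL.
have T12 := T1_T2_T3 SR SL Um Up Phim Phip GU.
move: CFL T12; set T := T3 _ _ _ _ _ _ _ => {}CFL T12.
have UnewE : Unew = U - lambda *: T.
  by rewrite scheme /T /T3 -addrA -opprD -scalerDr addrA.
set D := hll_entropy_flux SR SL U Up - hll_entropy_flux SR SL Um U in T12 *.
have stay : lambda *: T = 0 -> 0 <= - (lambda * D) ->
    entropy Unew <= entropy U - lambda * D.
  by move=> T0 H; rewrite UnewE T0 subr0 lerDl.
have [T0|T0] := eqVneq T 0.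
  apply: stay; first by rewrite T0 scaler0.
  rewrite -mulrN mulr_ge0// oppr_ge0.
  by move: T12; rewrite T0 dentropy0 subr0 => <-; rewrite subr_le0 (le_trans T1le).
set S := [set sigma_max (hess entropy eta) | eta in segm U Unew] in CFL *.
have [ubS|nubS] := pselect (has_ubound S); last first.
  have S0 : sup S = 0 by apply: sup_out => -[_].
  have l0 : lambda = 0.
    by apply/le_anti; rewrite lambda_ge0 andbT; have := CFL T0; rewrite S0 invr0 mulr0.
  by apply: stay; rewrite l0 ?scale0r// mul0r oppr0.
apply: le_trans (segment_entropy_le GU GUnew ubS) _; rewrite -/S.
have -> : Unew - U = - lambda *: T by rewrite UnewE addrC addKr scaleNr.
clearbody T; rewrite dentropyZ dotvZl dotvZr.
have N0 : 0 < dotv T T by rewrite dotv_gt0.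
have {}CFL := CFL T0; rewrite sqr_norm2 in CFL.
have -> : dentropy U T = D - (T1 SR SL U Up Phip - T2 SR SL Um U Phim).
  by rewrite T12 opprB addrC subrK.
set a := T1 _ _ _ _ _ in CFL T1le *; set b := T2 _ _ _ _ _ in CFL T2ge *.
suff H : sup S * (lambda * dotv T T) <= 2 * (b - a).
  by have := ler_wpM2l lambda_ge0 H; clear; lra.
have [M0|M0] := leP (sup S) 0.
  apply: (@le_trans _ _ 0); last by rewrite mulr_ge0// subr_ge0 (le_trans T1le).
  by apply: mulr_le0_ge0 => //; apply: mulr_ge0 => //; exact: ltW.
move: CFL; rewrite !ler_pdivlMr//.
by rewrite mulrA [sup S * _]mulrC.
Qed.
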